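(* Let $\mathcal{F}$ be an admissable collection of polynomials and let $S=S(\mathcal{F})$ be the semigroup generated by $\mathcal{F}$ under composition. Suppose $S$ is right amenable. For $A,B\in S$ write $A\approx B$ if there exists $X\in S$ with $X\circ A=X\circ B$ (under these hypotheses this is an equivalence relation, and $S/_\approx$ is a semigroup with the induced multiplication). Then there exist a polynomial $P$ and an isomorphism $\phi:S/_\approx\to E(P)$.
   Context: Rational maps are non-constant; $S(\mathcal{F})$ consists of all finite non-empty compositions of elements of $\mathcal{F}$. A rational map is exceptional if it has degree $1$ or is Möbius conjugate to $z^n$ ($n\in\mathbb{Z}$), to a Chebyshev polynomial, or to a Lattès map. A collection $\mathcal{F}$ of rational maps is admissable if it contains a non-exceptional element $g$ and either (i) $g$ is not Möbius conjugate to a polynomial; or (ii) $g$ is conjugate to a polynomial but there is another element $g_1\in\mathcal{F}$ such that no Möbius map simultaneously conjugates $g$ and $g_1$ to polynomials; or (iii) $\mathcal{F}$ consists of rational maps simultaneously Möbius conjugate to a family of polynomials $\mathcal{F}'$ and there is a disk $D_{\mathcal{F}}$ centered at $\infty$ with $P(D_{\mathcal{F}})\subset D_{\mathcal{F}}$ for every $P\in\mathcal{F}'$. For a semigroup $S$, let $L_\infty(S)$ be the Banach space of bounded complex functions on $S$ with sup norm; a mean is a continuous linear functional $M$ with $M(\phi)\ge0$ for $\phi\ge0$ and $\|M\|=M(\chi_S)=1$, where $\chi_S$ is the constant function $1$. $S$ is right amenable if there is a mean $M$ with $M(r_s\phi)=M(\phi)$ for all $s\in S$, $\phi\in L_\infty(S)$,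 where $r_s(\phi)(x)=\phi(xs)$. For a rational map $Q$, the Lyubich operator on $C(\overline{\mathbb{C}})$ is $L_Q(\phi)(y)=\frac{1}{\deg Q}\sum_{Q(x)=y}\phi(x)$ (with multiplicity), with dual $L_Q^*$ acting on measures. For a rational map $R$ with $\deg R\ge2$, $m_R$ is its measure of maximal entropy, and $E(R)$ is the semigroup (under composition) of all rational maps $Q$ with $L_Q^*(m_R)=m_R$.
   Formalization: ''Isomorphism φ: S/≈ → E(P)'' is read as an isomorphism onto a subsemigroup of E(P) (injective homomorphism): onto E(P) fails for F={z²+1}, where S/≈ has no identity while every E(P) contains the identity map. *)

(* Defs.v *)
From HB Require Import structures.
From mathcomp Require Import all_boot all_order all_algebra.
From mathcomp Require Import all_classical all_reals all_analysis.
From mathcomp Require Import complex.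

Set Implicit Arguments.
Unset Strict Implicit.
Unset Printing Implicit Defensive.

Import Order.TTheory GRing.Theory Num.Theory.
Import numFieldNormedType.Exports.

Local Open Scope classical_set_scope.
Local Open Scope ring_scope.
Local Open Scope quotient_scope.

(* [R[i]] itself carries no topology; typed as a [numFieldType] it inherits the
   topology and the normed space structure of its modulus. *)
Definition Cplx (R : realType) : numFieldType := R[i]%C.

Definition sphere (R : realType) : Type := one_point_compactification (Cplx R).
HB.instance Definition _ (R : realType) := Pointed.on (sphere R).
HB.instance Definition _ (R : realType) := Topological.on (sphere R).

Definition selfmap (R : realType) : Type := sphere R -> sphere R.
HB.instance Definition _ (R : realType) := Choice.on (selfmap R).

Definition Borel (R : realType) := g_sigma_algebraType (@open (sphere R)).

Section Rational.
Variable R : realType.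
Local Notation C := (Cplx R).
Local Notation S2 := (sphere R).
Implicit Types (p q : {poly C}) (f g h : selfmap R).

Definition fracdeg (pq : {poly C} * {poly C}) : nat :=
  (maxn (size pq.1) (size pq.2)).-1.

(* With d the degree of p/q, its value at infinity is the quotient of the
   coefficients of degree d. *)
Definition fracmap (pq : {poly C} * {poly C}) : selfmap R := fun x =>
  let: (p, q) := pq in
  match x with
  | Some z => if q.[z] == 0 then None else Some (p.[z] / q.[z])
  | None => let d := fracdeg pq in
            if q`_d == 0 then None else Some (p`_d / q`_d)
  end.

(* Lowest terms and positive degree: constants are excluded. *)
Definition fraction_of f : set ({poly C} * {poly C}) :=
  [set pq | [/\ coprimep pq.1 pq.2, (0 < fracdeg pq)%N & f = fracmap pq]].

Definition rational_map f : Prop := exists pq, fraction_of f pq.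

(* A lowest-terms fraction is determined by the map up to a common constant
   factor, which affects neither [deg] nor [mult]. *)
Definition frac f : {poly C} * {poly C} := xget (0, 1) (fraction_of f).

Definition deg f : nat := fracdeg (frac f).

(* The local degree of f = p/q at x: with F = p - f(x) q (F = q when f(x) is
   infinite), this is the multiplicity of x as a root of F; at infinity it is
   deg f - deg F. *)
Definition mult f (x : S2) : nat :=
  let: (p, q) := frac f in
  let F := if f x is Some y then p - y *: q else q in
  if x is Some z then mup z F else (maxn (size p) (size q) - size F)%N.

Definition polynomial_map f : Prop :=
  exists2 p : {poly C}, (1 < size p)%N & f = fracmap (p, 1).

Definition moebius h : Prop := rational_map h /\ deg h = 1%N.

(* h \o f \o h^-1 = g *)
Definition conj_by h f g : Prop := h \o f = g \o h.

Definition moebius_conj f g : Prop := exists2 h, moebius h & conj_by h f g.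

Definition zpow (n : int) : selfmap R :=
  match n with
  | Posz m => fracmap ('X^m, 1)
  | Negz m => fracmap (1, 'X^(m.+1))
  end.

Fixpoint chebyshev (n : nat) : {poly C} :=
  match n with
  | 0 => 1
  | n1.+1 => match n1 with
             | 0 => 'X
             | n2.+1 => ('X * chebyshev n1) *+ 2 - chebyshev n2
             end
  end.

Definition chart0 (x : S2) : C := if x is Some z then z else 0.
Definition chart_oo (x : S2) : C := if x is Some z then z^-1 else 0.

Definition holomorphic_at (Theta : C -> S2) (t : C) : Prop :=
  (\forall s \near t, Theta s <> None /\ derivable (chart0 \o Theta) s 1) \/
  (\forall s \near t, Theta s <> Some 0 /\ derivable (chart_oo \o Theta) s 1).

Definition lattice (w1 w2 : C) : set C :=
  [set z | exists m n : int, z = m%:~R * w1 + n%:~R * w2].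

(* A rational map of degree at least 2 which is semiconjugate, by a nonconstant
   holomorphic map Theta, to an affine map t |-> a t + b of a torus C / L.
   As w2 / 0 = 0, the condition on Im says that w1, w2 are R-independent. *)
Definition lattes f : Prop :=
  [/\ rational_map f, (1 < deg f)%N &
   exists (w1 w2 a b : C) (Theta : C -> S2), let L := lattice w1 w2 in
   [/\ complex.Im (w2 / w1) != 0,
       forall l, L l -> L (a * l),
       (forall t, holomorphic_at Theta t) /\ (exists s t, Theta s <> Theta t),
       forall l t, L l -> Theta (t + l) = Theta t
     & forall t, Theta (a * t + b) = f (Theta t)]].

Definition exceptional f : Prop :=
  [\/ deg f = 1%N,
      exists n : int, moebius_conj f (zpow n),
      exists n : nat, moebius_conj f (fracmap (chebyshev n, 1))
    | exists2 g, lattes g & moebius_conj f g].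

Definition polynomial_by h f : Prop :=
  exists2 P, polynomial_map P & conj_by h f P.

Definition disk_oo (r : R) : set S2 :=
  [set x | if x is Some z then r%:C%C < `|z| else True].

Definition admissable (F : set (selfmap R)) : Prop :=
  (forall f, F f -> rational_map f) /\
  exists g, [/\ F g, ~ exceptional g &
   [\/ ~ (exists2 h, moebius h & polynomial_by h g),
       (exists2 h, moebius h & polynomial_by h g) /\
       (exists g1, [/\ F g1, g1 <> g &
          ~ exists h, [/\ moebius h, polynomial_by h g & polynomial_by h g1]])
     | exists h, [/\ moebius h, forall f, F f -> polynomial_by h f &
         let F' := [set P | polynomial_map P /\
                            exists2 f, F f & conj_by h f P] in
         exists2 r : R, 0 < r &
           forall P, F' P -> P @` disk_oo r `<=` disk_oo r]]].

Inductive generated (F : set (selfmap R)) : selfmap R -> Prop :=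
| gen_base f : F f -> generated F f
| gen_comp f g : generated F f -> generated F g -> generated F (f \o g).

Definition Sgen (F : set (selfmap R)) : Type := set_type (generated F).
HB.instance Definition _ F := Choice.on (Sgen F).

Fact Sgen_mul_subproof F (x y : Sgen F) :
  (val x \o val y : selfmap R) \in (generated F : set _).
Proof.
by apply/mem_set/gen_comp; [exact: set_mem (valP x) | exact: set_mem (valP y)].
Qed.

Definition Sgen_mul F (x y : Sgen F) : Sgen F :=
  exist _ (val x \o val y) (Sgen_mul_subproof x y).

Fact Sgen_mulA F : associative (@Sgen_mul F).
Proof. by move=> x y z; apply: val_inj. Qed.

HB.instance Definition _ F := isSemigroup.Build (Sgen F) (@Sgen_mulA F).

End Rational.

Section Amenability.
Variables (R : realType) (S : semigroupType).
Local Notation C := (Cplx R).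
Implicit Types (phi psi : S -> C) (M : (S -> C) -> C).

Definition modulus (z : C) : R := complex.Re (`|z| : C).

Definition Linfty : set (S -> C) :=
  [set phi | exists B : R, forall s, modulus (phi s) <= B].

Definition supnorm phi : R := sup [set modulus (phi s) | s in [set: S]].

(* A functional on [Linfty] is given by its values there; its values on
   unbounded functions are irrelevant. *)
Definition opnorm M : R :=
  sup [set modulus (M phi) | phi in [set phi | Linfty phi /\ supnorm phi <= 1]].

(* In [R[i]], [0 <= z] means that z is a nonnegative real. *)
Definition mean M : Prop :=
  [/\ forall (a : C) phi psi, Linfty phi -> Linfty psi ->
        M (fun s => a * phi s + psi s) = a * M phi + M psi,
      exists K : R, forall phi, Linfty phi -> modulus (M phi) <= K * supnorm phi,
      forall phi, Linfty phi -> (forall s, 0 <= phi s) -> 0 <= M phi,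
      opnorm M = 1
    & M (fun=> 1) = 1].

Definition rtrans (s : S) phi : S -> C := fun x => phi (x * s)%g.

Definition right_amenable : Prop :=
  exists2 M, mean M & forall s phi, Linfty phi -> M (rtrans s phi) = M phi.

Definition lcan (a b : S) : bool := `[< exists x : S, (x * a = x * b)%g >].

(* Two left ideals S x and S y of full mean cannot be disjoint. *)
Lemma right_amenable_lmult : right_amenable ->
  forall x y : S, exists u v : S, (u * x = v * y)%g.
Proof.
move=> [M [linM _ posM _ M1] invM] x y; apply: contrapT => disj.
pose ch (z : S) : S -> C :=
  fun t => if `[< exists u : S, t = (u * z)%g >] then 1 else 0.
have mod1 : modulus 1 = 1 by rewrite /modulus normr1.
have mod0 : modulus 0 = 0 by rewrite /modulus normr0.
have Lch z : Linfty (ch z).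
  by exists 1 => s; rewrite /ch; case: ifP => _; rewrite ?mod1 ?mod0.
have L1 : Linfty (fun=> 1) by exists 1 => s; rewrite mod1.
have Mch z : M (ch z) = 1.
  rewrite -(invM z _ (Lch z)) -[RHS]M1; congr M; apply/funext => s.
  by rewrite /rtrans /ch ifT//; apply/asboolP; exists s.
pose rest : S -> C := fun s => -1 * ch x s + (-1 * ch y s + 1).
have Lrest1 : Linfty (fun s => -1 * ch y s + 1).
  exists 1 => s; rewrite /ch; case: ifP => _;
  by rewrite ?mulr1 ?addNr ?mulr0 ?add0r ?mod1 ?mod0.
have cases s : rest s = 1 \/ rest s = 0.
  rewrite /rest /ch; case: asboolP => [[u su]|_]; case: asboolP => [[v sv]|_].
  - by exfalso; apply: disj; exists u, v; rewrite -su.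
  - by right; rewrite mulr1 mulr0 add0r addNr.
  - by right; rewrite mulr0 add0r mulr1 addNr.
  - by left; rewrite !mulr0 !add0r.
have Lrest : Linfty rest.
  by exists 1 => s; case: (cases s) => ->; rewrite ?mod1 ?mod0.
have rest0 s : 0 <= rest s by case: (cases s) => ->.
have := posM rest Lrest rest0.
rewrite /rest linM// linM// !Mch M1 mulr1 addNr addr0.
by rewrite oppr_ge0 ler10.
Qed.

Hypothesis am : right_amenable.

Fact lcan_refl : reflexive lcan.
Proof. by move=> a; apply/asboolP; exists a. Qed.

Fact lcan_sym : symmetric lcan.
Proof.
by move=> a b; apply/asboolP/asboolP => -[x e]; exists x.
Qed.

Fact lcan_trans : transitive lcan.
Proof.
move=> b a c /asboolP[x eab] /asboolP[y ebc]; apply/asboolP.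
have [u [v e]] := right_amenable_lmult am x y.
by exists (u * x)%g; rewrite -mulgA eab mulgA e -!mulgA ebc.
Qed.

Fact lcanM a a' b b' : lcan a a' -> lcan b b' -> lcan (a * b)%g (a' * b')%g.
Proof.
move=> /asboolP[x ea] /asboolP[y eb]; apply: (@lcan_trans (a' * b)%g).
  by apply/asboolP; exists x; rewrite !mulgA ea.
apply/asboolP; have [u [v e]] := right_amenable_lmult am a' y.
by exists u; rewrite !mulgA e -!mulgA eb.
Qed.

Definition lcan_equiv := EquivRel lcan lcan_refl lcan_sym lcan_trans.

End Amenability.

Definition lcan_quot (R : realType) (S : semigroupType)
  (am : right_amenable R S) : Type := {eq_quot lcan_equiv am}.

Section Quotient.
Variables (R : realType) (S : semigroupType) (am : right_amenable R S).
Local Notation Q := (lcan_quot am).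

HB.instance Definition _ := Choice.on Q.
HB.instance Definition _ := EqQuotient.on Q.

Definition lcan_mul (x y : Q) : Q := \pi_Q (repr x * repr y)%g.

Lemma pi_lcanP (a b : S) : reflect (\pi_Q a = \pi_Q b) (lcan a b).
Proof. exact: (@eqmodP _ (lcan_equiv am)). Qed.

Lemma pi_lcan_mul (a b : S) : \pi_Q (a * b)%g = lcan_mul (\pi_Q a) (\pi_Q b).
Proof. by apply/pi_lcanP/(lcanM am); apply/pi_lcanP; rewrite reprK. Qed.

Fact lcan_mulA : associative lcan_mul.
Proof.
move=> x y z; rewrite -[x]reprK -[y]reprK -[z]reprK.
rewrite -(pi_lcan_mul (repr y) (repr z)) -(pi_lcan_mul (repr x) (repr y)).
by rewrite -(pi_lcan_mul (repr x)) -(pi_lcan_mul _ (repr z)) mulgA.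
Qed.

HB.instance Definition _ := isSemigroup.Build Q lcan_mulA.

End Quotient.

Section Entropy.
Context {d : measure_display} {T : measurableType d} {R : realType}.
Variables (mu : probability T R) (f : T -> T).

Definition invariant : Prop :=
  forall A, measurable A -> mu (f @^-1` A) = mu A.

(* The entropy of the join of the partitions f^{-j} xi, j < n, where xi is the
   partition into the level sets of a map to 'I_k; recall that ln 0 = 0. *)
Definition join_entropy (k : nat) (xi : T -> 'I_k) (n : nat) : R :=
  \sum_(w : {ffun 'I_n -> 'I_k})
    let t := fine (mu [set x | forall j : 'I_n, xi (iter j f x) = w j]) in
    - (t * ln t).

Definition entropy : \bar R :=
  ereal_sup [set h | exists (k : nat) (xi : T -> 'I_k),
    (forall i, measurable (xi @^-1` [set i])) /\
    h = limn (fun n => (join_entropy xi n / n%:R)%:E)].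

End Entropy.

Definition max_entropy_measure (R : realType) (f : selfmap R)
    (m : probability (Borel R) R) : Prop :=
  invariant m f /\
  forall nu : probability (Borel R) R, invariant nu f ->
    (entropy nu f <= entropy m f)%E.

Section Lyubich.
Variable R : realType.
Local Notation C := (Cplx R).
Local Notation S2 := (sphere R).

Definition lyubich (Q : selfmap R) (phi : S2 -> C) : S2 -> C := fun y =>
  (deg Q)%:R^-1 * \sum_(x \in Q @^-1` [set y]) (mult Q x)%:R * phi x.

Definition cintegral (m : probability (Borel R) R) (phi : S2 -> C) : C :=
  (Rintegral m setT (fun x => complex.Re (phi x))
   +i* Rintegral m setT (fun x => complex.Im (phi x)))%C.

(* The dual measure, as the functional it defines on continuous functions. *)
Definition lyubich_dual (Q : selfmap R) (m : probability (Borel R) R) :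
  (S2 -> C) -> C := fun phi => cintegral m (lyubich Q phi).

Definition lyubich_fixed (Q : selfmap R) (m : probability (Borel R) R) : Prop :=
  forall phi : S2 -> C, continuous phi -> lyubich_dual Q m phi = cintegral m phi.

(* For f rational with deg f > 1, the measure of maximal entropy exists and is
   unique. Note that E f contains the identity, so that a semigroup without
   identity (such as the one generated by f) may embed in E f but is never
   isomorphic to the whole of it. *)
Definition E (f : selfmap R) : set (selfmap R) :=
  [set Q | rational_map Q /\
    exists2 m, max_entropy_measure f m & lyubich_fixed Q m].

End Lyubich.

(* Main.v *)
(* We take P = z ^ 2, so that E(P) contains all c z ^ n with c a root of unity:
   the measure of maximal entropy of z ^ 2 is Lebesgue measure on the unit circle.

   The invariant disk bounds the roots of s - y0 uniformly in s, after an affine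
   conjugation, so the mean over s of the average of a polynomial phi over the
   roots of s - y0 is a linear functional ell on polynomials. Right invariance
   gives ell (phi o A) = ell phi for A in S, and also the Newton identities of A
   with power sums (deg A) ell (X ^ k). Hence, with mu = ell X, two elements A, B
   of S of the same degree satisfy A - mu = z (B - mu) with z ^ m = 1 as soon as
   ell ((X - mu) ^ m) <> 0; and if there were no such m > 0, every A in S would
   have the form mu + a (X - mu) ^ n and be exceptional.

   After a scaling that makes some element g of S of degree d > 1 monic,
   comparing g o t with t o g shows that the leading coefficient c_t of each t
   has finite order N = (d - 1) m. Moreover X o A = X o B if and only if A and B
   have the same degree and (c_A / c_B) ^ deg X = 1. So if n0 is the degree of an
   element of S for which gcd (n0, N) is largest, then
   A |-> c_A ^ n0 z ^ (deg A) induces the embedding of the quotient.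

   For the entropy of z ^ 2, code a point of the circle by its half plane. Under
   the circle measure the symbols are independent and uniform, which gives ln 2.
   For any invariant nu, the codes of length K determine a finite Borel partition
   up to a small error when K is large; the Gibbs inequality against the
   probability that is uniform on the codes and nearly deterministic on the
   symbols given the codes bounds the entropy by ln 2. *)
From HB Require Import structures.
From mathcomp Require Import all_boot all_order all_algebra.
From mathcomp Require Import all_classical all_reals all_analysis.
From mathcomp Require Import complex measurable_realfun ring lra zify.
Require Import Defs.

Set Implicit Arguments.
Unset Strict Implicit.
Unset Printing Implicit Defensive.

Import Order.TTheory GRing.Theory Num.Theory.
Import numFieldNormedType.Exports.

Local Open Scope classical_set_scope.
Local Open Scope ring_scope.

(** * Averages over roots *)

Lemma size_sub_polyC (A : nzRingType) (p : {poly A}) y : (1 < size p)%N ->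
  size (p - y%:P) = size p.
Proof.
by move=> sp; rewrite size_polyDl// size_polyN (leq_ltn_trans (size_polyC_leq1 _)).
Qed.

Lemma lead_coef_sub_polyC (A : nzRingType) (p : {poly A}) y : (1 < size p)%N ->
  lead_coef (p - y%:P) = lead_coef p.
Proof.
by move=> sp; rewrite lead_coefDl// size_polyN (leq_ltn_trans (size_polyC_leq1 _)).
Qed.

Section RootAverages.
Variable K : numClosedFieldType.
Implicit Types (p s A phi psi : {poly K}) (r : seq K).

(** The roots are listed with multiplicity in an unspecified order, so facts about them hold up to
    [perm_eq]. *)
Definition rootseq p : seq K := sval (closed_field_poly_normal p).

Lemma rootseqE p : p = lead_coef p *: \prod_(z <- rootseq p) ('X - z%:P).
Proof. exact: svalP (closed_field_poly_normal p). Qed.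

Lemma perm_rootseq p a r : a != 0 ->
  p = a *: \prod_(z <- r) ('X - z%:P) -> perm_eq (rootseq p) r.
Proof.
move=> a0 pE; apply: prod_XsubC_eq.
have lcp : lead_coef p = a.
  by rewrite pE lead_coefZ (monicP (monic_prod_XsubC _ _ _)) mulr1.
by apply: (scalerI a0); rewrite -pE -{1}lcp -rootseqE.
Qed.

Lemma size_rootseq p : p != 0 -> size (rootseq p) = (size p).-1.
Proof.
move=> p0; rewrite [in RHS](rootseqE p) size_scale ?lead_coef_eq0//.
by rewrite size_prod_XsubC.
Qed.

Lemma mem_rootseq p x : p != 0 -> (x \in rootseq p) = root p x.
Proof.
move=> p0; rewrite [p in RHS]rootseqE rootZ ?lead_coef_eq0//.
by rewrite root_prod_XsubC.
Qed.

(** Substituting A into the factorisation of s gives a product of the A - y over the roots y of s,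
    and each factor splits in turn. *)
Lemma rootseq_comp s A : s != 0 -> (1 < size A)%N ->
  perm_eq (rootseq (s \Po A))
          (flatten [seq rootseq (A - y%:P) | y <- rootseq s]).
Proof.
move=> s0 sA; have A0 : lead_coef A != 0.
  by rewrite lead_coef_eq0 -size_poly_gt0 (ltn_trans _ sA).
apply: (@perm_rootseq _ (lead_coef s * lead_coef A ^+ size (rootseq s))).
  by rewrite mulf_neq0 ?lead_coef_eq0// expf_neq0.
rewrite {1}(rootseqE s) comp_polyZ -scalerA; congr (_ *: _).
elim: (rootseq s) => [|y r IH] /=.
  by rewrite !big_nil scale1r /= comp_polyC.
rewrite big_cons comp_polyM IH comp_polyB comp_polyX comp_polyC.
rewrite {1}(rootseqE (A - y%:P)) lead_coef_sub_polyC// big_cat/= exprS -scalerA.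
by rewrite -scalerAl -scalerAr.
Qed.

Definition rootavg p phi : K :=
  (\sum_(x <- rootseq p) phi.[x]) / (size p).-1%:R.

Lemma rootavg_comp s A phi : (1 < size s)%N -> (1 < size A)%N ->
  rootavg (s \Po A) phi =
  (\sum_(y <- rootseq s) rootavg (A - y%:P) phi) / (size s).-1%:R.
Proof.
move=> ss sA; have s0 : s != 0 by rewrite -size_poly_gt0 (ltn_trans _ ss).
rewrite /rootavg (perm_big _ (rootseq_comp s0 sA))/= big_flatten big_map.
under [in RHS]eq_bigr do rewrite size_sub_polyC//.
rewrite -mulr_suml -mulrA -invfM -natrM.
by rewrite size_comp_poly [in RHS]mulnC.
Qed.

Lemma rootavgC p c : (1 < size p)%N -> rootavg p c%:P = c.
Proof.
move=> sp; have p0 : p != 0 by rewrite -size_poly_gt0 (ltn_trans _ sp).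
rewrite /rootavg; under eq_bigr do rewrite hornerC.
rewrite big_const_seq count_predT iter_addr_0 size_rootseq// -[c *+ _]mulr_natr mulfK//.
by rewrite pnatr_eq0 -lt0n -subn1 subn_gt0.
Qed.

(** On the roots of A - y the composite psi o A is constant, equal to psi(y). *)
Lemma rootavg_shift A y psi : (1 < size A)%N ->
  rootavg (A - y%:P) (psi \Po A) = psi.[y].
Proof.
move=> sA; have szB := size_sub_polyC y sA.
have B0 : A - y%:P != 0 by rewrite -size_poly_gt0 szB (ltn_trans _ sA).
rewrite -[RHS](@rootavgC (A - y%:P)) ?szB//; congr (_ / _).
apply: eq_big_seq => x; rewrite mem_rootseq// rootE !hornerE subr_eq0 => /eqP Ax.
by rewrite horner_comp Ax.
Qed.

Lemma rootavg_comp_comp s A psi : (1 < size s)%N -> (1 < size A)%N ->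
  rootavg (s \Po A) (psi \Po A) = rootavg s psi.
Proof.
move=> ss sA; rewrite rootavg_comp//; congr (_ / _).
by apply: eq_bigr => y _; rewrite rootavg_shift.
Qed.

Lemma horner_drop_poly A i x :
  (drop_poly i A).[x] = A`_i + x * (drop_poly i.+1 A).[x].
Proof.
suff -> : drop_poly i A = (A`_i)%:P + drop_poly i.+1 A * 'X.
  by rewrite !hornerE mulrC.
apply/polyP => j; rewrite coefD coefC coefMX !coef_drop_poly.
by case: j => [|j] /=; rewrite ?addr0 ?add0r// addSnnS.
Qed.

(* Horner's scheme: the coefficients of (A(X) - A(x)) / (X - x). *)
Definition horner_quot A x : {poly K} :=
  \poly_(i < size A) (drop_poly i.+1 A).[x].

Lemma coef_horner_quot A x i : (horner_quot A x)`_i = (drop_poly i.+1 A).[x].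
Proof.
rewrite coef_poly; case: ltnP => // Ai.
by rewrite drop_poly_eq0 ?horner0// (leq_trans Ai).
Qed.

Lemma horner_quotE A x : A - A.[x]%:P = horner_quot A x * ('X - x%:P).
Proof.
apply/polyP => i; rewrite mulrBr coefB coefC coefB coefMX coefMC.
case: i => [|i] /=; rewrite !coef_horner_quot.
  have := horner_drop_poly A 0 x; rewrite drop_poly0l => ->.
  by rewrite opprD addrA subrr !sub0r mulrC.
by rewrite horner_drop_poly subr0 mulrC addrK.
Qed.

(** This is the product rule: Q x is the product with one factor X - x removed. Describing Q by an
    equation avoids choosing an occurrence of a repeated root. *)
Lemma deriv_prod_XsubC r (Q : K -> {poly K}) :
  (forall x, x \in r -> \prod_(z <- r) ('X - z%:P) = Q x * ('X - x%:P)) ->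
  (\prod_(z <- r) ('X - z%:P))^`() = \sum_(x <- r) Q x.
Proof.
elim: r Q => [|y r IH] Q QE; first by rewrite !big_nil derivC.
rewrite !big_cons derivM derivXsubC mul1r; congr (_ + _).
  apply: (mulIf (negbT (polyXsubC_eq0 y))).
  by rewrite -QE ?mem_head// big_cons mulrC.
rewrite (IH (fun x => (\prod_(z <- r) ('X - z%:P)) %/ ('X - x%:P))).
  rewrite mulr_sumr; apply: eq_big_seq => x xr.
  have /divpK rE : ('X - x%:P) %| \prod_(z <- r) ('X - z%:P).
    by rewrite dvdp_XsubCl root_prod_XsubC.
  apply: (@mulIf _ ('X - x%:P)); first by rewrite polyXsubC_eq0.
  by rewrite -mulrA rE -QE ?big_cons// inE xr orbT.
move=> x xr; rewrite divpK// dvdp_XsubCl root_prod_XsubC//.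
Qed.

(* Newton's identities: a power sum of the roots of A - y of order below the
   degree does not depend on y. *)
Lemma rootavg_newton A y i : (1 < size A)%N ->
  rootavg (A - y%:P) (drop_poly i.+1 A) = A^`()`_i / (size A).-1%:R.
Proof.
move=> sA; have szB := size_sub_polyC y sA.
have B0 : A - y%:P != 0 by rewrite -size_poly_gt0 szB (ltn_trans _ sA).
rewrite /rootavg szB; congr (_ / _).
pose a := lead_coef (A - y%:P); pose r := rootseq (A - y%:P).
have a0 : a != 0 by rewrite lead_coef_eq0.
have BE : A - y%:P = a *: \prod_(z <- r) ('X - z%:P) by exact: rootseqE.
(* At a root x of A - y one has A(x) = y, so [horner_quot A x] is (A - y) / (X - x). The product
   rule sums these quotients, and their coefficients of index i are the values of
   [drop_poly i.+1 A]. *)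
have -> : A^`() = \sum_(x <- r) horner_quot A x.
  rewrite -[A](subrK y%:P) derivD derivC addr0 subrK BE derivZ.
  rewrite (@deriv_prod_XsubC _ (fun x => a^-1 *: horner_quot A x)).
    by rewrite scaler_sumr; apply: eq_bigr => x _; rewrite scalerA divff// scale1r.
  move=> x; rewrite mem_rootseq// rootE !hornerE subr_eq0 => /eqP Ax.
  by apply: (scalerI a0); rewrite -BE -scalerAl scalerA divff// scale1r -Ax horner_quotE.
by rewrite coef_sum; apply: eq_bigr => x _; rewrite coef_horner_quot.
Qed.

Lemma rootavg_comp_newton s A i : (1 < size s)%N -> (1 < size A)%N ->
  rootavg (s \Po A) (drop_poly i.+1 A) = A^`()`_i / (size A).-1%:R.
Proof.
move=> ss sA; rewrite rootavg_comp//.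
under eq_bigr do rewrite rootavg_newton//.
by rewrite -[RHS](@rootavgC s) // /rootavg; under [in RHS]eq_bigr do rewrite hornerC.
Qed.

Lemma rootavg_is_linear p a phi psi :
  rootavg p (a *: phi + psi) = a * rootavg p phi + rootavg p psi.
Proof.
rewrite /rootavg mulrA -mulrDl mulr_sumr -big_split/=; congr (_ / _).
by apply: eq_bigr => x _; rewrite !hornerE.
Qed.

(** The constant does not depend on p. This uniformity makes the root average a bounded function on
    the semigroup, to which a mean can be applied. *)
Lemma rootavg_bounded phi (B : K) : exists C : K, forall p, (1 < size p)%N ->
  (forall x, root p x -> `|x| <= B) -> `|rootavg p phi| <= C.
Proof.
exists (\sum_(i < size phi) `|phi`_i| * B ^+ i) => p sp pB.
have p0 : p != 0 by rewrite -size_poly_gt0 (ltn_trans _ sp).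
have n0 : (0 < (size p).-1)%N by rewrite -subn1 subn_gt0.
rewrite normrM normfV normr_nat ler_pdivrMr ?ltr0n//.
apply: le_trans (ler_norm_sum _ _ _) _.
rewrite mulr_natr -size_rootseq// -[X in _ *+ X]count_predT -iter_addr_0.
rewrite -big_const_seq big_seq [leRHS]big_seq; apply: ler_sum => x.
rewrite mem_rootseq// => /pB xB; rewrite horner_coef.
apply: le_trans (ler_norm_sum _ _ _) _; apply: ler_sum => i _.
by rewrite normrM normrX ler_wpM2l// lerXn2r// ?nnegrE// (le_trans _ xB).
Qed.

End RootAverages.

(** * Linear functionals on polynomials that are invariant under composition *)

Section InvariantFunctional.
Variables (K : numClosedFieldType) (ell : {poly K} -> K).
Hypothesis ell_lin : forall a phi psi,
  ell (a *: phi + psi) = a * ell phi + ell psi.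
Hypothesis ell1 : ell 1 = 1.

(** The last clause is the form in which Newton's identities survive averaging: its right-hand side
    is the common value of the averages of [drop_poly i.+1 A] over the roots of A - y, for all y. *)
Definition ell_invariant (A : {poly K}) : Prop :=
  [/\ (1 < size A)%N, forall psi, ell (psi \Po A) = ell psi
    & forall i, ell (drop_poly i.+1 A) = A^`()`_i / (size A).-1%:R].

Let mu := ell 'X.

Lemma ell0 : ell 0 = 0.
Proof. by have := ell_lin (-1) 1 1; rewrite scaleN1r addNr mulN1r addNr. Qed.

Lemma ellZ a phi : ell (a *: phi) = a * ell phi.
Proof. by rewrite -[a *: phi]addr0 ell_lin ell0 addr0. Qed.

Lemma ellD phi psi : ell (phi + psi) = ell phi + ell psi.
Proof. by rewrite -{1}[phi]scale1r ell_lin mul1r. Qed.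

Lemma ellC c : ell c%:P = c.
Proof. by rewrite -[c%:P]mulr1 mul_polyC ellZ ell1 mulr1. Qed.

Lemma ellB phi psi : ell (phi - psi) = ell phi - ell psi.
Proof. by rewrite ellD -scaleN1r ellZ mulN1r. Qed.

Lemma ell_sum I (r : seq I) (P : pred I) (G : I -> {poly K}) :
  ell (\sum_(i <- r | P i) G i) = \sum_(i <- r | P i) ell (G i).
Proof. exact: (big_morph ell ellD ell0). Qed.

Lemma ell_inv_id A : ell_invariant A -> ell A = mu.
Proof. by case=> _ eA _; rewrite /mu -(eA 'X) comp_polyX. Qed.

(* The Newton identities determine every coefficient of A from the leading one,
   except the constant coefficient, which is given by ell A = ell X. *)
Lemma same_size_affine A B : ell_invariant A -> ell_invariant B ->
  size A = size B ->
  lead_coef B *: (A - mu%:P) = lead_coef A *: (B - mu%:P).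
Proof.
move=> iA iB sAB; have [sA _ nA] := iA; have [sB _ nB] := iB.
set a := lead_coef A; set b := lead_coef B.
(* The leading terms cancel in D, while D inherits from A and B the Newton identities with the
   denominator n = deg A, which exceeds deg D. *)
pose D := b *: A - a *: B; pose n := (size A).-1.
have n0 : n%:R != 0 :> K by rewrite pnatr_eq0 -lt0n /n -subn1 subn_gt0.
have nD i : ell (drop_poly i.+1 D) = D^`()`_i / n%:R.
  rewrite /D -scaleNr addrC drop_polyD !drop_polyZ ell_lin ellZ nA nB -sAB -/n.
  by rewrite derivD !derivZ coefD !coefZ !mulrA mulrDl.
have sD : (size D <= n)%N.
  apply/leq_sizeP => j; rewrite leq_eqVlt => /predU1P[<-|nj].
    rewrite coefB !coefZ /n {2}sAB -[A`__]/(lead_coef A) -[B`__]/(lead_coef B).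
    by rewrite mulrC subrr.
  rewrite coefB !coefZ !nth_default ?mulr0 ?subrr// -?sAB.
    by move: nj; rewrite /n; case: (size A).
  by move: nj; rewrite /n; case: (size A).
(* If D had degree m + 1 > 0, the identity of index m would read n D_(m+1) = (m+1) D_(m+1), forcing
   n = m + 1 although deg D < n. *)
have s1 : (size D <= 1)%N.
  rewrite leqNgt; apply/negP => s2.
  pose m := (size D).-2; have sDE : size D = m.+2.
    by rewrite /m; case: (size D) s2 => [|[]].
  have := nD m; rewrite coef_deriv.
  have -> : drop_poly m.+1 D = (D`_m.+1)%:P.
    apply/polyP => -[|j]; rewrite coef_drop_poly coefC//=.
    by rewrite nth_default// sDE addSn addnS !ltnS leq_addl.
  rewrite ellC => /(congr1 ( *%R^~ n%:R)); rewrite divfK// => /eqP.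
  rewrite -[eqbRHS]mulr_natr -subr_eq0 -mulrBr mulf_eq0.
  have -> : (D`_m.+1 == 0) = false.
    have -> : D`_m.+1 = lead_coef D by rewrite lead_coefE sDE.
    by rewrite lead_coef_eq0 -size_poly_eq0 sDE.
  rewrite /= subr_eq0 eqr_nat => /eqP nm.
  by move: sD; rewrite sDE nm ltnn.
have DE : D = ((b - a) * mu)%:P.
  rewrite (size1_polyC s1); congr (_%:P); rewrite -(ellC D`_0) -size1_polyC//.
  rewrite ellB !ellZ ell_inv_id// ell_inv_id// mulrBl//.
have -> : b *: (A - mu%:P) = D + a *: B - b *: mu%:P by rewrite subrK scalerBr.
rewrite DE -!mul_polyC polyCM polyCB; ring.
Qed.

(** In the Taylor expansion of phi at mu only the constant term contributes. *)
Lemma ell_eval : (forall m, (0 < m)%N -> ell (('X - mu%:P) ^+ m) = 0) ->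
  forall phi, ell phi = phi.[mu].
Proof.
move=> cm phi; rewrite -[phi in LHS](comp_polyXr).
have -> : 'X = ('X + mu%:P) \Po ('X - mu%:P) :> {poly K}.
  by rewrite comp_polyD comp_polyX comp_polyC subrK.
rewrite comp_polyA; set psi := phi \Po ('X + mu%:P).
rewrite comp_polyE ell_sum.
have -> : phi.[mu] = psi`_0.
  by rewrite -horner_coef0 /psi horner_comp !hornerE.
case sz: (size psi) => [|n].
  by rewrite big_ord0 nth_default// sz.
rewrite big_ord_recl big1 => [|i _]; last by rewrite ellZ cm// mulr0.
by rewrite addr0 expr0 ellZ ell1 mulr1.
Qed.

(** Comparing coefficients in Euler's equation gives (n - i) B_i = 0. *)
Lemma euler_monomial (B : {poly K}) n : n%:R *: B = 'X * B^`() -> B = B`_n *: 'X^n.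
Proof.
move=> BE; apply/polyP => i; rewrite coefZ coefXn; case: eqVneq => [->|ni].
  by rewrite mulr1.
rewrite mulr0; move/polyP/(_ i)/eqP: BE; rewrite coefZ coefXM coef_deriv.
have -> : (if i == 0 then 0 else B`_i.-1.+1 *+ i.-1.+1) = i%:R * B`_i.
  by case: i ni => [|i] _ /=; rewrite ?mul0r// mulr_natl.
rewrite -subr_eq0 -mulrBl mulf_eq0 subr_eq0 eqr_nat eq_sym (negbTE ni).
by move/eqP.
Qed.

(** Here ell is evaluation at mu, so Newton's identities say that (A - A(mu)) / (X - mu) equals A' /
    n. After translating mu to 0 this is Euler's equation. *)
Lemma degenerate_monomial A : ell_invariant A ->
  (forall m, (0 < m)%N -> ell (('X - mu%:P) ^+ m) = 0) ->
  A = mu%:P + lead_coef A *: ('X - mu%:P) ^+ (size A).-1.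
Proof.
move=> iA cm; have ev := ell_eval cm; have [sA _ nA] := iA.
set n := (size A).-1.
have n0 : n%:R != 0 :> K by rewrite pnatr_eq0 -lt0n /n -subn1 subn_gt0.
have Amu : A.[mu] = mu by rewrite -ev ell_inv_id.
have AE : n%:R *: (A - mu%:P) = ('X - mu%:P) * A^`().
  rewrite -[X in A - X%:P]Amu horner_quotE scalerAl mulrC; congr (_ * _).
  apply/polyP => i; rewrite coefZ coef_horner_quot -ev nA mulrC divfK//.
pose B := (A - mu%:P) \Po ('X + mu%:P).
have shiftK (q : {poly K}) : (q \Po ('X + mu%:P)) \Po ('X - mu%:P) = q.
  by rewrite -comp_polyA comp_polyD comp_polyX comp_polyC subrK comp_polyXr.
have BE : n%:R *: B = 'X * B^`().
  rewrite /B -comp_polyZ AE comp_polyM comp_polyB comp_polyX comp_polyC addrK.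
  by rewrite deriv_comp derivB derivC subr0 derivD derivX derivC addr0 mulr1.
have := shiftK (A - mu%:P); rewrite -/B (euler_monomial BE).
rewrite comp_polyZ comp_Xn_poly => AmE.
have -> : lead_coef A = B`_n.
  have /(congr1 (fun p : {poly K} => lead_coef p)) := AmE.
  rewrite lead_coefZ lead_coef_exp lead_coefXsubC expr1n mulr1 => ->.
  by rewrite lead_coef_sub_polyC.
by rewrite AmE addrC subrK.
Qed.

(** Since A - mu = z (B - mu), applying ell to the m-th powers gives e = z ^ m e with e = ell ((X -
    mu) ^ m), because ell is invariant under composition with A and with B. *)
Lemma same_size_ratio A B m : ell_invariant A -> ell_invariant B ->
  size A = size B -> ell (('X - mu%:P) ^+ m) != 0 ->
  (lead_coef A / lead_coef B) ^+ m = 1.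
Proof.
move=> iA iB sAB em; have := same_size_affine iA iB sAB.
have [sA eA _] := iA; have [sB eB _] := iB.
have b0 : lead_coef B != 0 by rewrite lead_coef_eq0 -size_poly_gt0 (ltn_trans _ sB).
set z := _ / _ => AB.
have {}AB : A - mu%:P = z *: (B - mu%:P).
  by apply: (scalerI b0); rewrite AB scalerA /z mulrC divfK.
have shE C : (C - mu%:P) ^+ m = ('X - mu%:P) ^+ m \Po C.
  elim: m {em} => [|m IH]; first by rewrite !expr0 comp_polyC.
  by rewrite !exprS IH comp_polyM comp_polyB comp_polyX comp_polyC.
have : ell ((A - mu%:P) ^+ m) = z ^+ m * ell ((B - mu%:P) ^+ m).
  by rewrite AB exprZn ellZ.
rewrite (shE A) (shE B) eA eB.
by rewrite -{1}[ell _]mul1r => /(mulIf em).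
Qed.

End InvariantFunctional.

(** * Polynomial and rational maps of the sphere *)

Section PolynomialMaps.
Variable R : realType.
Local Notation C := (Cplx R).
Implicit Types (p q : {poly C}) (f g h : selfmap R).

Lemma fracmap_poly_Some p (z : C) : fracmap (p, 1) (Some z) = Some p.[z].
Proof. by rewrite /fracmap hornerC oner_eq0 divr1. Qed.

Lemma fracmap_poly_None p : (1 < size p)%N -> fracmap (p, 1) None = None.
Proof.
move=> sp; rewrite /fracmap /fracdeg /= size_poly1.
by rewrite (maxn_idPl (ltnW sp)) coef1 -subn1 subn_eq0 leqNgt sp eqxx.
Qed.

Lemma size_comp_gt1 p q : (1 < size p)%N -> (1 < size q)%N ->
  (1 < size (p \Po q)%R)%N.
Proof.
move=> sp sq; rewrite -subn_gt0 subn1 size_comp_poly muln_gt0.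
by rewrite -!subn1 !subn_gt0 sp.
Qed.

Lemma fracmap_poly_comp p q : (1 < size p)%N -> (1 < size q)%N ->
  fracmap (p, 1) \o fracmap (q, 1) = fracmap (p \Po q, 1).
Proof.
move=> sp sq; apply/funext => -[z|]; rewrite /comp.
  by rewrite !fracmap_poly_Some horner_comp.
by rewrite !fracmap_poly_None// size_comp_gt1.
Qed.

Lemma horner_inj p q : (forall z, p.[z] = q.[z]) -> p = q.
Proof.
move=> pq; apply/eqP; rewrite -subr_eq0; apply/negPn/negP => d0.
pose rs : seq C := [seq i%:R | i <- iota 0 (size (p - q))].
have ars : all (root (p - q)) rs by apply/allP => z _; rewrite rootE !hornerE pq subrr.
have urs : uniq rs.
  by rewrite map_inj_uniq ?iota_uniq// => i j /eqP; rewrite eqr_nat => /eqP.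
by have := max_poly_roots d0 ars urs; rewrite size_map size_iota ltnn.
Qed.

Lemma fracmap_poly_inj p q : fracmap (p, 1) = fracmap (q, 1) -> p = q.
Proof.
move=> pq; apply: horner_inj => z.
have : fracmap (p, 1) (Some z) = fracmap (q, 1) (Some z) by rewrite pq.
by rewrite !fracmap_poly_Some => -[].
Qed.

(** Equality of the maps gives p q' = p' q at every point, both sides vanishing at the common zeros
    of q and q'. Coprimality then makes q and q' divide each other. *)
Lemma fraction_of_uniq f pq pq' : fraction_of f pq -> fraction_of f pq' ->
  exists2 k : C, k != 0 & pq' = (k *: pq.1, k *: pq.2).
Proof.
case: pq pq' => [p q] [p' q'] [/= cpq dpq fpq] [/= cpq' dpq' fpq'].
have nz (u v : {poly C}) : coprimep u v -> (0 < fracdeg (u, v))%N -> v != 0.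
  move=> cuv duv; apply/eqP => v0; move: cuv duv.
  rewrite v0 coprimep0 /fracdeg/= size_poly0 maxn0 => /eqp_size ->.
  by rewrite size_poly1.
have q0 := nz _ _ cpq dpq; have q'0 := nz _ _ cpq' dpq'.
have E : p * q' = p' * q.
  apply: horner_inj => z; rewrite !hornerM.
  have : fracmap (p, q) (Some z) = fracmap (p', q') (Some z) by rewrite -fpq -fpq'.
  rewrite /fracmap.
  case: eqVneq => [->|qz]; case: eqVneq => [->|qz'] //.
    by rewrite !mulr0.
  move=> -[] /(congr1 ( *%R^~ (q.[z] * q'.[z]))).
  by rewrite mulrA divfK// mulrCA divfK// => ->; rewrite mulrC.
have qq' : q %| q'.
  by rewrite -(Gauss_dvdpr _ (_ : coprimep q p)) 1?coprimep_sym// E dvdp_mull.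
have q'q : q' %| q.
  by rewrite -(Gauss_dvdpr _ (_ : coprimep q' p')) 1?coprimep_sym// -E dvdp_mull.
have /eqpfP : q' %= q by rewrite /eqp qq' q'q.
set k := lead_coef q' / lead_coef q => kE.
have k0 : k != 0 by rewrite /k mulf_neq0 ?invr_eq0 ?lead_coef_eq0.
exists k => //=; rewrite -kE; congr (_, _).
by apply: (mulIf q0); rewrite -E {1}kE -scalerAr -scalerAl.
Qed.

Lemma fraction_of_poly p : (1 < size p)%N -> fraction_of (fracmap (p, 1)) (p, 1).
Proof.
move=> sp; split=> //=; first exact: coprimep1.
by rewrite /fracdeg/= size_poly1 (maxn_idPl (ltnW sp)) -subn1 subn_gt0.
Qed.

(** [frac] selects an arbitrary representative of the fraction, so it is known only up to a constant
    factor. *)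
Lemma frac_poly p : (1 < size p)%N ->
  exists2 k : C, k != 0 & frac (fracmap (p, 1)) = (k *: p, k%:P).
Proof.
move=> sp; have fp := fraction_of_poly sp.
have [k k0 kE] := fraction_of_uniq fp (xgetPex (0, 1) (ex_intro _ _ fp)).
by exists k => //; rewrite /frac kE/= -alg_polyC.
Qed.

Lemma deg_poly p : (1 < size p)%N -> deg (fracmap (p, 1)) = (size p).-1.
Proof.
move=> sp; have [k k0 kE] := frac_poly sp; rewrite /deg kE /fracdeg/=.
by rewrite size_scale// size_polyC k0 (maxn_idPl (ltnW sp)).
Qed.

Lemma rational_poly p : (1 < size p)%N -> rational_map (fracmap (p, 1)).
Proof. by move=> sp; exists (p, 1); exact: fraction_of_poly. Qed.

Lemma moebius_poly p : size p = 2 -> moebius (fracmap (p, 1)).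
Proof. by move=> sp; split; [apply: rational_poly|rewrite deg_poly]; rewrite sp. Qed.

Lemma only_root_monomial p (z0 : C) : (1 < size p)%N ->
  (forall w, p.[w] = z0 -> w = z0) ->
  p = z0%:P + lead_coef p *: ('X - z0%:P) ^+ (size p).-1.
Proof.
move=> sp pr; have szB := size_sub_polyC z0 sp.
have B0 : p - z0%:P != 0 by rewrite -size_poly_gt0 szB (ltn_trans _ sp).
apply/eqP; rewrite addrC -subr_eq; apply/eqP.
rewrite [LHS](@rootseqE R[i] (p - z0%:P)) lead_coef_sub_polyC//; congr (_ *: _).
rewrite -szB -(@size_rootseq R[i])//.
have : {in @rootseq R[i] (p - z0%:P), forall x, x = z0}.
  move=> x; rewrite mem_rootseq// rootE !hornerE subr_eq0 => /eqP; exact: pr.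
elim: (@rootseq R[i] (p - z0%:P)) => [|x r IH] xz; first by rewrite big_nil.
rewrite big_cons exprS IH => [|y yr]; last by apply: xz; rewrite inE yr orbT.
by rewrite (xz x (mem_head _ _)).
Qed.

(** In degree n > 1 the affine map k (z - z0) with k ^ (n - 1) = a conjugates the polynomial to z ^
    n; in degree 1 nothing is to be shown. *)
Lemma exceptional_monomial p (z0 a : C) : (1 < size p)%N ->
  p = z0%:P + a *: ('X - z0%:P) ^+ (size p).-1 -> exceptional (fracmap (p, 1)).
Proof.
move=> sp; have [s2 _|s3] := leqP (size p) 2.
  by constructor 1; rewrite deg_poly//; case: (size p) sp s2 => [|[|[]]].
set n := (size p).-1 => pE; constructor 2; exists n.
have n1 : (0 < n.-1)%N by move: s3; rewrite /n; case: (size p) => [|[|[]]].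
pose k : C := n.-1.-root (a : R[i]).
have ka : k ^+ n.-1 = a by exact: (@rootCK R[i] n.-1 n1 a).
have a0 : a != 0.
  apply/eqP => a0; move: sp; rewrite pE a0 scale0r addr0 ltnNge.
  by rewrite size_polyC_leq1.
have k0 : k != 0.
  by apply/eqP => k0; move: a0; rewrite -ka k0 expr0n eqn0Ngt n1 eqxx.
pose q : {poly C} := k *: ('X - z0%:P).
have sq : size q = 2 by rewrite size_scale// size_XsubC.
have n2 : (1 < size ('X^n : {poly C}))%N.
  by rewrite size_polyXn ltnS; case: (n) n1.
exists (fracmap (q, 1)); first exact: moebius_poly.
rewrite /conj_by/= !fracmap_poly_comp// ?sq//; congr (fracmap (_, _)).
rewrite comp_Xn_poly {1}/q comp_polyZ comp_polyB comp_polyX comp_polyC.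
rewrite {1}pE addrC addKr scalerA /q exprZn -ka -exprS prednK//.
by case: (n) n1.
Qed.

End PolynomialMaps.

(** * Admissable families of polynomials *)

Section Admissable.
Variable R : realType.
Local Notation C := (Cplx R).
Implicit Types (p q : {poly C}) (f g h : selfmap R) (F : set (selfmap R)).

Lemma fracmap_scale p q (k : C) : k != 0 ->
  fracmap (k *: p, k *: q) = fracmap (p, q).
Proof.
move=> k0; apply/funext => -[z|]; rewrite /fracmap /fracdeg/=.
  by rewrite !hornerZ mulf_eq0 (negbTE k0)/= invfM mulrACA divff// mul1r.
rewrite !size_scale// !coefZ mulf_eq0 (negbTE k0)/=.
by rewrite invfM mulrACA divff// mul1r.
Qed.

Lemma moebius_fraction h : moebius h ->
  exists p q, [/\ coprimep p q, maxn (size p) (size q) = 2 & h = fracmap (p, q)].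
Proof.
move=> [[pq hpq]]; rewrite /deg /frac; have := xgetPex (0, 1) (ex_intro _ _ hpq).
case: xget => p q [/= cpq dpq hE] d1; exists p, q; split=> //.
by move: d1; rewrite /fracdeg/=; case: maxn => [|[|[]]].
Qed.

(* A Moebius map conjugating a polynomial to a polynomial fixes infinity unless
   its pole is a totally invariant point of the polynomial. *)
Lemma moebius_conj_affine h p P : (1 < size p)%N -> moebius h ->
  ~ exceptional (fracmap (p, 1)) -> polynomial_map P ->
  conj_by h (fracmap (p, 1)) P ->
  exists2 l : {poly C}, size l = 2 & h = fracmap (l, 1).
Proof.
move=> sp /moebius_fraction[a [b [cab sab hE]]] nex [P0 sP0 PE] cj.
have [sb|sb] := leqP (size b) 1.
  have sa : size a = 2.
    by move: sab; rewrite maxnE; case: (size a) sb => [|[|[|n]]]; case: (size b) => [|[]].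
  have b0 : b != 0.
    apply/eqP => b0; move: cab; rewrite b0 coprimep0 => /eqp_size.
    by rewrite sa size_poly1.
  have [c c0 bE] : exists2 c : C, c != 0 & b = c%:P.
    exists b`_0; last exact: size1_polyC.
    by apply: contra_neq b0 => b0; rewrite (size1_polyC sb) b0.
  exists (c^-1 *: a); first by rewrite size_scale ?invr_eq0.
  rewrite hE -(@fracmap_scale _ _ c^-1) ?invr_eq0//; congr (fracmap (_, _)).
  by rewrite bE -mul_polyC -polyCM mulVf.
have sb2 : size b = 2.
  by apply/eqP; rewrite eqn_leq sb andbT -sab leq_maxr.
have d1 : fracdeg (a, b) = 1%N by rewrite /fracdeg/= sab.
have b1 : b`_1 != 0.
  have -> : b`_1 = lead_coef b by rewrite lead_coefE sb2.
  by rewrite lead_coef_eq0 -size_poly_eq0 sb2.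
pose z0 : C := - b`_0 / b`_1.
have bE z : b.[z] = b`_1 * (z - z0).
  rewrite horner_coef sb2 !big_ord_recl big_ord0 /= expr0 mulr1 addr0 expr1.
  by rewrite /bump/= mulrBr /z0 mulrCA divff// mulr1 opprK addrC.
have hpole w : h w = None -> w = Some z0.
  rewrite hE /fracmap; case: w => [w|]; last by rewrite d1 (negbTE b1).
  case: eqVneq => // /eqP; rewrite bE mulf_eq0 (negbTE b1) subr_eq0.
  by move=> /eqP ->.
have hz0 : h (Some z0) = None by rewrite hE /fracmap bE subrr mulr0 eqxx.
have Pfin x : P x = None -> x = None.
  by rewrite PE; case: x => // x; rewrite fracmap_poly_Some.
have cjE x : h (fracmap (p, 1) x) = P (h x) by exact: (congr1 (@^~ x) cj).
(* If p(w) = z0 then P(h(w)) is infinite, hence so is h(w), and w is the only pole z0 of h. Thus p -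
   z0 has no root other than z0, and p is conjugate to a power. *)
exfalso; apply: nex; apply: (@exceptional_monomial _ p z0 (lead_coef p)) => //.
apply: only_root_monomial => // w pw.
have := cjE (Some w); rewrite fracmap_poly_Some pw hz0 => /esym/Pfin/hpole.
by case.
Qed.

Lemma polynomial_generated F : (forall f, F f -> polynomial_map f) ->
  forall s, generated F s -> polynomial_map s.
Proof.
move=> pF s; elim=> [|f g _ [p sp ->] _ [q sq ->]]; first exact: pF.
by exists (p \Po q); [exact: size_comp_gt1|exact: fracmap_poly_comp].
Qed.

Lemma moebius_id : moebius (fracmap ('X, 1) : selfmap R).
Proof. by apply: moebius_poly; rewrite size_polyX. Qed.

Lemma polynomial_by_id f : polynomial_map f ->
  polynomial_by (fracmap ('X, 1)) f.
Proof.
move=> [p sp fE]; exists f; first by exists p.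
by rewrite /conj_by fE !fracmap_poly_comp ?size_polyX// comp_polyX comp_polyXr.
Qed.

(** The first two clauses of admissability fail for polynomials, as the identity conjugates each of
    them to itself. In the third, h is affine and the whole semigroup preserves the pullback of the
    disk by h. *)
Lemma admissable_bounded F : (forall f, F f -> polynomial_map f) ->
  admissable F ->
  exists g : selfmap R, [/\ F g, ~ exceptional g &
    exists y0 B : C, forall s x, generated F s ->
      s (Some x) = Some y0 -> `|x| <= B].
Proof.
move=> pF [_ [g [Fg nex]]].
case=> [[]|[_ [g1 [Fg1 _ []]]]|[h [mh hF]]].
- by exists (fracmap ('X, 1)); [exact: moebius_id|exact/polynomial_by_id/pF].
- by exists (fracmap ('X, 1)); split; [exact: moebius_id|exact/polynomial_by_id/pF..].
move=> /= [r r0 hr]; exists g; split=> //.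
have [p sp gE] := pF _ Fg; have [P pP cj] := hF _ Fg.
have [l sl hE] : exists2 l : {poly C}, size l = 2 & h = fracmap (l, 1).
  by apply: (@moebius_conj_affine h p P); rewrite -?gE.
have l1 : l`_1 != 0.
  have -> : l`_1 = lead_coef l by rewrite lead_coefE sl.
  by rewrite lead_coef_eq0 -size_poly_eq0 sl.
have lE z : l.[z] = l`_0 + l`_1 * z.
  rewrite horner_coef sl !big_ord_recl big_ord0 /= expr0 mulr1 addr0 expr1.
  by [].
have stable s x : generated F s -> disk_oo r (h x) -> disk_oo r (h (s x)).
  move=> gs; elim: gs x => [f Ff x hx|f1 f2 _ IH1 _ IH2 x hx]; last exact/IH1/IH2.
  have [Q pQ cjQ] := hF _ Ff.
  rewrite -[h (f x)]/((h \o f) x) cjQ.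
  by apply: (hr Q); [split=> //; exists f|exists (h x)].
(* The point y0 is the preimage of 0 under h and so lies outside the pulled back disk. Hence s(x) =
   y0 forces |h(x)| <= r, which bounds x by B. *)
exists (- l`_0 / l`_1), ((r%:C%C + `|l`_0|) / `|l`_1|) => s x gs sx.
have : ~ disk_oo r (h (Some x)).
  move=> /(stable _ _ gs); rewrite sx hE fracmap_poly_Some lE.
  rewrite mulrCA divff// mulr1 subrr /disk_oo/= normr0 => r0'.
  by have := lt_trans (_ : 0 < r%:C%C) r0'; rewrite ltxx ltcR => /(_ r0).
rewrite hE fracmap_poly_Some /disk_oo/= lE => /negP.
rewrite -real_leNgt ?normr_real//; last first.
  by rewrite realE lecR (ltW r0).
move=> lr; rewrite ler_pdivlMr ?normr_gt0// -normrM mulrC.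
rewrite -[_ * x](addKr l`_0) addrC.
by rewrite (le_trans (ler_normB _ _))// lerD2r.
Qed.

End Admissable.

(** * Semigroups of polynomials with a right-invariant mean *)

Section AmenablePolynomials.
Variables (R : realType) (F : set (selfmap R)).
Hypothesis polyF : forall f, F f -> polynomial_map f.
Local Notation C := (Cplx R).
Local Notation S := (Sgen F).

Definition polyof (s : S) : {poly C} :=
  xget 0 [set p : {poly C} | (1 < size p)%N /\ val s = fracmap (p, 1)].

Lemma polyofP (s : S) : (1 < size (polyof s))%N /\ val s = fracmap (polyof s, 1).
Proof.
have [p sp sE] := polynomial_generated polyF (set_mem (valP s)).
exact: (@xgetPex _ 0 [set p : {poly C} | (1 < size p)%N /\ val s = fracmap (p, 1)]
  (ex_intro _ p (conj sp sE))).
Qed.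

Lemma size_polyof s : (1 < size (polyof s))%N. Proof. by case: (polyofP s). Qed.

Lemma polyofE s : val s = fracmap (polyof s, 1). Proof. by case: (polyofP s). Qed.

Lemma polyof_inj : injective polyof.
Proof. by move=> s t st; apply: val_inj; rewrite !polyofE st. Qed.

Lemma polyofM s t : polyof (s * t)%g = polyof s \Po polyof t.
Proof.
apply: fracmap_poly_inj; rewrite -polyofE -fracmap_poly_comp ?size_polyof//.
by rewrite -!polyofE.
Qed.

Variables (M : (S -> C) -> C) (y0 B : C).
Hypothesis M_mean : mean M.
Hypothesis M_inv : forall s phi, Linfty phi -> M (rtrans s phi) = M phi.
Hypothesis rootB : forall s x, generated F s -> s (Some x) = Some y0 -> `|x| <= B.

Let avg phi (s : S) : C := @rootavg R[i] (polyof s - y0%:P) phi.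
Let ell phi : C := M (avg phi).

Let size_sub s : size (polyof s - y0%:P) = size (polyof s).
Proof. by rewrite size_sub_polyC// size_polyof. Qed.

(** All roots of s - y0 are bounded by B, whatever s is. *)
Let avg_bounded phi : Linfty (avg phi).
Proof.
have [K hK] := @rootavg_bounded R[i] phi B.
exists (complex.Re K) => s.
have : `|avg phi s| <= K.
  apply: hK; first by rewrite size_sub size_polyof.
  move=> x; rewrite rootE !hornerE subr_eq0 => /eqP sx.
  apply: (@rootB (val s)); first exact: set_mem (valP s).
  by rewrite polyofE fracmap_poly_Some sx.
by rewrite lecE => /andP[].
Qed.

Let ell_lin a phi psi : ell (a *: phi + psi) = a * ell phi + ell psi.
Proof.
case: M_mean => linM _ _ _ _; rewrite /ell -linM//; congr M; apply/funext => s.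
exact: (@rootavg_is_linear R[i]).
Qed.

Let ell1 : ell 1 = 1.
Proof.
case: M_mean => _ _ _ _ M1; rewrite -[RHS]M1; congr M; apply/funext => s.
by apply: (@rootavgC R[i]); rewrite size_sub size_polyof.
Qed.

Let avgM phi (s t : S) :
  avg phi (s * t)%g = @rootavg R[i] ((polyof s - y0%:P) \Po polyof t) phi.
Proof. by rewrite /avg polyofM comp_polyB comp_polyC. Qed.

(* Right invariance of M replaces s by s * t, and the roots of (s o t) - y0 are
   the points that t maps to the roots of s - y0. *)
Lemma polyof_invariant t : @ell_invariant R[i] ell (polyof t).
Proof.
have st := size_polyof t; split=> // [psi|i].
  rewrite /ell -[LHS](M_inv t)//; congr M; apply/funext => s.
  rewrite /rtrans avgM (@rootavg_comp_comp R[i])//.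
  by rewrite size_sub size_polyof.
rewrite -[RHS](@ellC R[i] ell ell_lin ell1) /ell -[LHS](M_inv t)//.
congr M; apply/funext => s; rewrite /rtrans avgM (@rootavg_comp_newton R[i])//.
  by rewrite /avg (@rootavgC R[i])// size_sub size_polyof.
by rewrite size_sub size_polyof.
Qed.

(** Both parts come from A - mu = z (B - mu), where z is the ratio of the leading coefficients. A
    suitable m exists because otherwise all centred moments of ell vanish and g is conjugate to a
    power or has degree 1. *)
Lemma polyof_same_size (g : S) : ~ exceptional (val g) ->
  (forall s t, size (polyof s) = size (polyof t) ->
     lead_coef (polyof s) = lead_coef (polyof t) -> s = t) /\
  exists2 m, (0 < m)%N & forall s t, size (polyof s) = size (polyof t) ->
     (lead_coef (polyof s) / lead_coef (polyof t)) ^+ m = 1.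
Proof.
move=> nex; split.
  move=> s t sst lst; apply: polyof_inj.
  have := @same_size_affine R[i] ell ell_lin ell1 _ _ (polyof_invariant s)
    (polyof_invariant t) sst.
  rewrite lst => /scalerI h; apply: (addIr (- (ell 'X)%:P)); apply: h.
  by rewrite lead_coef_eq0 -size_poly_gt0 (ltn_trans _ (size_polyof t)).
have [cm|/existsNP[m /not_implyP[m0 em]]] :=
    pselect (forall m, (0 < m)%N -> ell (('X - (ell 'X)%:P) ^+ m) = 0).
  exfalso; apply: nex; rewrite polyofE.
  apply: (@exceptional_monomial _ _ (ell 'X) (lead_coef (polyof g))).
    exact: size_polyof.
  exact: (@degenerate_monomial R[i] ell ell_lin ell1 _ (polyof_invariant g) cm).
exists m => // s t sst; apply: (@same_size_ratio R[i] ell ell_lin ell1) => //.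
- exact: polyof_invariant.
- exact: polyof_invariant.
- exact/eqP.
Qed.

End AmenablePolynomials.

(** * From leading coefficients to roots of unity *)

Section LeadingCoefficients.
Variables (K : numClosedFieldType) (S : semigroupType).
Variables (dg : S -> nat) (lc : S -> K) (g : S) (m : nat).
Hypothesis dg_gt0 : forall s, (0 < dg s)%N.
Hypothesis dgM : forall s t, dg (s * t)%g = (dg s * dg t)%N.
Hypothesis lc_neq0 : forall s, lc s != 0.
Hypothesis lcM : forall s t, lc (s * t)%g = lc s * lc t ^+ dg s.
Hypothesis dg_lc_inj : forall s t, dg s = dg t -> lc s = lc t -> s = t.
Hypothesis g_gt1 : (1 < dg g)%N.
Hypothesis m_gt0 : (0 < m)%N.
Hypothesis ratio : forall s t, dg s = dg t -> (lc s / lc t) ^+ m = 1.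

(* The leading coefficients become roots of unity of bounded order after a
   scaling that makes g monic; the power n0 then kills exactly the roots of
   unity that some element of S identifies by composition on the left. *)
Lemma leading_coef_character : exists (N : nat) (c : S -> K),
  [/\ (0 < N)%N, forall s, c s ^+ N = 1,
      forall s t, c (s * t)%g = c s * c t ^+ dg s
    & forall s t, (dg s = dg t /\ c s = c t) <-> exists x, (x * s = x * t)%g].
Proof.
have d1 : (0 < (dg g).-1)%N by rewrite -subn1 subn_gt0.
(* Conjugation by a scaling with ratio k divides the leading coefficient of s by k ^ (deg s - 1);
   this k makes that of g equal to 1. *)
pose k : K := (dg g).-1.-root (lc g).
have kE : k ^+ (dg g).-1 = lc g by exact: rootCK.
have k0 : k != 0.
  apply/eqP => k0; have := lc_neq0 g.
  by rewrite -kE k0 expr0n eqn0Ngt d1 eqxx.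
pose c0 s := lc s / k ^+ (dg s).-1.
have kn n : k ^+ n != 0 by rewrite expf_neq0.
have c0_neq0 s : c0 s != 0 by rewrite mulf_neq0 ?invr_eq0.
have c0M s t : c0 (s * t)%g = c0 s * c0 t ^+ dg s.
  rewrite /c0 lcM dgM exprMn exprVn -exprM mulrACA -invfM -exprD.
  congr (_ / k ^+ _); case: (dg s) (dg_gt0 s) (dg t) (dg_gt0 t) => [|a] // _ [|b] // _.
  by nia.
have c0ratio s t : dg s = dg t -> (c0 s / c0 t) ^+ m = 1.
  move=> dst; rewrite -(ratio dst) /c0 dst invfM invrK mulrACA mulVf ?mulr1//.
have c0g : c0 g = 1 by rewrite /c0 -kE divff// expf_neq0.
pose N := ((dg g).-1 * m)%N.
have N0 : (0 < N)%N by rewrite muln_gt0 d1.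
(* The elements g s and s g have the same degree, and their normalised leading coefficients are
   c0(s) ^ deg g and c0(s). The m-th power of the ratio is 1. *)
have c0N s : c0 s ^+ N = 1.
  have := c0ratio (g * s)%g (s * g)%g; rewrite !dgM mulnC => /(_ erefl).
  rewrite !c0M c0g mul1r expr1n mulr1.
  by rewrite -{1}(prednK (ltnW g_gt1)) exprSr mulfK// -exprM.
(* A maximal gcd exists since all of them divide N. *)
have [x0 x0max] : exists x0, forall x, (gcdn (dg x) N <= gcdn (dg x0) N)%N.
  pose P n := `[< exists x, gcdn (dg x) N = n >].
  have exP : exists n, P n by exists (gcdn (dg g) N); apply/asboolP; exists g.
  have bP n : P n -> (n <= N)%N by move=> /asboolP[x <-]; rewrite dvdn_leq ?dvdn_gcdr.
  case: (ex_maxnP exP bP) => _ /asboolP[x0 <-] x0P; exists x0 => x.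
  by apply: x0P; apply/asboolP; exists x.
exists N, (fun s => c0 s ^+ dg x0); split=> // [s|s t|s t].
- by rewrite exprAC c0N expr1n.
- by rewrite c0M exprMn exprAC.
split=> [[dst cst]|[x xst]].
  exists x0; apply: dg_lc_inj; rewrite ?dgM ?dst// !lcM; congr (_ * _).
  move: cst; rewrite /c0 dst !exprMn => /mulIf; apply.
  by rewrite expf_neq0 ?invr_eq0.
have dst : dg s = dg t.
  have /eqP := congr1 dg xst; rewrite !dgM eqn_pmul2l ?dg_gt0// => /eqP //.
split=> //; pose z := c0 s / c0 t.
have zx : z ^+ dg x = 1.
  have E : c0 s ^+ dg x = c0 t ^+ dg x.
    by apply: (mulfI (c0_neq0 x)); rewrite -!c0M xst.
  by rewrite /z exprMn exprVn E divff// expf_neq0.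
have zN : z ^+ N = 1 by rewrite /z exprMn exprVn !c0N divr1.
(* The order j of z divides N and deg x, hence also gcd (deg (x x0), N). By maximality this gcd
   equals gcd (deg x0, N), so j divides deg x0. *)
have [j oz oN] := prim_order_exists N0 zN.
have ox : (j %| dg x)%N by rewrite (prim_order_dvd oz) zx.
have g1 : (gcdn (dg x0) N %| gcdn (dg (x * x0)%g) N)%N.
  by rewrite dvdn_gcd dvdn_gcdr dgM dvdn_mull ?dvdn_gcdl.
have g2 : gcdn (dg x0) N = gcdn (dg (x * x0)%g) N.
  apply/eqP; rewrite eqn_leq x0max andbT dvdn_leq// gcdn_gt0 N0 orbT//.
have ox0 : (j %| dg x0)%N.
  apply: (@dvdn_trans (gcdn (dg x0) N)); last exact: dvdn_gcdl.
  by rewrite g2 dvdn_gcd oN dgM dvdn_mulr.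
have /eqP : z ^+ dg x0 == 1 by rewrite -(prim_order_dvd oz).
rewrite /z exprMn exprVn => /(congr1 ( *%R^~ (c0 t ^+ dg x0))).
by rewrite divfK ?mul1r// expf_neq0.
Qed.
End LeadingCoefficients.

(** * The circle measure *)

Section SphereBorel.
Variable R : realType.
Local Notation C := (Cplx R).
Local Notation S2 := (sphere R).
Local Notation B := (Borel R).

Lemma open_measurable_sphere (O : set S2) : open O -> measurable (O : set B).
Proof. by move=> opO; apply: sub_sigma_algebra. Qed.

Lemma measurable_fun_sphere d (T : measurableType d) (h : T -> B) :
  (forall O : set S2, open O -> measurable (h @^-1` O)) -> measurable_fun setT h.
Proof.
move=> hO; apply: (@measurability _ _ T B setT h (@open S2)) => //.
by move=> _ [V opV <-]; rewrite setTI; exact: hO.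
Qed.

Lemma measurable_Some (U : set C) : open U ->
  measurable ([set Some z | z in U] : set B).
Proof.
by move=> opU; apply: open_measurable_sphere; exact: one_point_compactification_open_some.
Qed.

Lemma measurable_infty : measurable ([set None] : set B).
Proof.
have -> : [set None] = ~` [set Some z | z in [set: C]] :> set S2.
  by apply/seteqP; split=> [x -> [z _]//|[z|]//= h]; exfalso; apply: h; exists z.
apply: measurableC; apply: measurable_Some; exact: openT.
Qed.

Lemma measurable_Some_closed (U : set C) : closed U ->
  measurable ([set Some z | z in U] : set B).
Proof.
move=> cU; have -> : [set Some z | z in U] =
    ~` ([set Some z | z in ~` U] `|` [set None]) :> set S2.
  apply/seteqP; split=> [_ [z Uz <-] [[w nUw [wz]]|]//|[z|] h].
  - by apply: nUw; rewrite wz.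
  - exists z => //; apply: contrapT => nUz; apply: h; left; by exists z.
  - by exfalso; apply: h; right.
apply: measurableC; apply: measurableU; last exact: measurable_infty.
apply: measurable_Some; exact: closed_openC.
Qed.

Lemma measurable_point (z : C) : measurable ([set Some z] : set B).
Proof.
have -> : [set Some z] = [set Some w | w in [set z]] :> set S2.
  by apply/seteqP; split=> [_ ->|_ [_ -> <-]]//; exists z.
apply: measurable_Some_closed.
by apply: compact_closed; [exact: norm_hausdorff|exact: compact_set1].
Qed.

(** The point at infinity is a measurable singleton, so only the finite part of a preimage needs
    attention. *)
Lemma measurable_fun_from_sphere d (T : measurableType d) (G : set (set T))
    (h : B -> T) : @measurable _ T = <<s G >> ->
  (forall O, G O -> measurable ([set Some z | z in (h \o Some) @^-1` O] : set B)) ->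
  measurable_fun setT h.
Proof.
move=> TG hO; apply: (@measurability _ _ B T setT h G) => // _ [V GV <-].
rewrite setTI; have [hN|hN] := pselect (V (h None)).
  have -> : h @^-1` V = [set Some z | z in (h \o Some) @^-1` V] `|` [set None].
    apply/seteqP; split=> [[z|] /= hz|x [[z Vz <-]//|->//]]; last by right.
    by left; exists z.
  by apply: measurableU; [exact: hO|exact: measurable_infty].
suff -> : h @^-1` V = [set Some z | z in (h \o Some) @^-1` V] by exact: hO.
by apply/seteqP; split=> [[z|] //= hz|x [z Vz <-]//]; exists z.
Qed.

Lemma monomial_continuous (c : C) n : continuous (fun z : C => c * z ^+ n).
Proof.
elim: n c => [|n IH] c z.
  by under eq_fun do rewrite expr0; exact: cst_continuous.
under eq_fun do rewrite exprSr mulrA.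
by apply: (@continuousM C C (fun z => c * z ^+ n) id z); [exact: IH|exact: cvg_id].
Qed.

Definition monomial (c : C) n : selfmap R := fracmap (c *: 'X^n, 1).

Lemma monomial_Some c n z : monomial c n (Some z) = Some (c * z ^+ n).
Proof. by rewrite /monomial fracmap_poly_Some !hornerE. Qed.

Lemma size_monomial (c : C) n : c != 0 -> size (c *: 'X^n : {poly C}) = n.+1.
Proof. by move=> c0; rewrite size_scale// size_polyXn. Qed.

Lemma monomial_None c n : c != 0 -> (0 < n)%N -> monomial c n None = None.
Proof. by move=> c0 n0; rewrite /monomial fracmap_poly_None// size_monomial. Qed.

Lemma measurable_monomial c n : measurable_fun setT (monomial c n : B -> B).
Proof.
apply: (@measurable_fun_from_sphere _ B (@open S2)) => // O opO.
apply: measurable_Some.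
have -> : (monomial c n \o Some) @^-1` O =
    (fun z : C => c * z ^+ n) @^-1` (Some @^-1` O).
  by apply/seteqP; split=> z /=; rewrite monomial_Some.
apply: open_comp => [z _|]; first exact: monomial_continuous.
apply: (@open_comp C S2 (Some : C -> S2)) => // z _.
exact: one_point_compactification_some_continuous.
Qed.

(** This is exp (2 pi i t), normalised to have period 1. *)
Definition cis (t : R) : C := (cos (pi *+ 2 * t) +i* sin (pi *+ 2 * t))%C.

Lemma cisD s t : cis (s + t) = cis s * cis t.
Proof.
rewrite /cis mulrDr cosD sinD; apply/eqP; rewrite eq_complex/= eqxx/=.
by rewrite addrC.
Qed.

Lemma cis0 : cis 0 = 1.
Proof. by rewrite /cis mulr0 cos0 sin0. Qed.

Lemma cis1 : cis 1 = 1.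
Proof. by rewrite /cis mulr1 cos2pi sin2pi. Qed.

Lemma cisMn t n : cis (t *+ n) = cis t ^+ n.
Proof.
elim: n => [|n IH]; first by rewrite mulr0n cis0 expr0.
by rewrite mulrS cisD IH exprS.
Qed.

Lemma norm_cis t : `|cis t| = 1.
Proof. by rewrite /cis normc_def/= cos2Dsin2 sqrtr1. Qed.

Lemma ReB (z w : C) : complex.Re (z - w) = complex.Re z - complex.Re w.
Proof. by case: z w => [? ?] [? ?]. Qed.

Lemma ImB (z w : C) : complex.Im (z - w) = complex.Im z - complex.Im w.
Proof. by case: z w => [? ?] [? ?]. Qed.

(** The squared modulus is taken in R because the norm of [C] has its values in [C]. *)
Definition sqnorm (z : C) : R := complex.Re z ^+ 2 + complex.Im z ^+ 2.

Lemma norm_sqnorm (z : C) : `|z| = (Num.sqrt (sqnorm z))%:C%C.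
Proof. by case: z => a b; exact: normc_def. Qed.

Lemma sqnorm0 : sqnorm 0 = 0.
Proof. by rewrite /sqnorm/= expr0n addr0. Qed.

Lemma sqnorm_ge0 z : 0 <= sqnorm z.
Proof. by rewrite addr_ge0// sqr_ge0. Qed.

Lemma sqnormB (z w : C) : sqnorm (z - w) =
  (complex.Re z - complex.Re w) ^+ 2 + (complex.Im z - complex.Im w) ^+ 2.
Proof. by rewrite /sqnorm ReB ImB. Qed.

Lemma sqnorm_gt0 z : z != 0 -> 0 < sqnorm z.
Proof.
move=> z0; rewrite lt_neqAle sqnorm_ge0 andbT eq_sym.
apply: contra z0; rewrite /sqnorm paddr_eq0 ?sqr_ge0// !sqrf_eq0 => /andP[a b].
by rewrite [z == 0](@eq_complex R z 0) a b.
Qed.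

Lemma complex_near (z : C) (U : set C) : nbhs z U -> exists2 e : R, 0 < e &
  forall w : C, `|complex.Re z - complex.Re w| < e ->
    `|complex.Im z - complex.Im w| < e -> U w.
Proof.
move=> /nbhs_ballP[/= e]; rewrite ltcE/= => /andP[/eqP e0 e1] zU.
exists (complex.Re e / 2); first by rewrite divr_gt0.
move=> w rw iw; apply: zU; rewrite /ball/=.
have -> : e = (complex.Re e)%:C%C by move: e0; case: (e) => a b /= ->.
rewrite norm_sqnorm sqnormB ltcR.
set a := _ - _ in rw *; set b := _ - _ in iw *.
have a2 : a ^+ 2 < (complex.Re e / 2) ^+ 2.
  by rewrite -real_normK ?num_real// ltrXn2r//= ltr_pwDl.
have b2 : b ^+ 2 < (complex.Re e / 2) ^+ 2.
  by rewrite -real_normK ?num_real// ltrXn2r//= ltr_pwDl.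
rewrite -[ltRHS]ger0_norm ?ltW// -sqrtr_sqr ltr_sqrt ?exprn_gt0//.
nra.
Qed.

Lemma Re_continuous : continuous (@complex.Re R : C -> R).
Proof.
move=> z U /nbhs_ballP[/= e e0 eU]; apply/nbhs_ballP.
exists e%:C%C => /=; first by rewrite ltcR.
move=> w zw; apply: eU; rewrite /ball/= -ltcR; apply: le_lt_trans zw.
by rewrite norm_sqnorm sqnormB lecR -sqrtr_sqr ler_wsqrtr// lerDl sqr_ge0.
Qed.

Lemma Im_continuous : continuous (@complex.Im R : C -> R).
Proof.
move=> z U /nbhs_ballP[/= e e0 eU]; apply/nbhs_ballP.
exists e%:C%C => /=; first by rewrite ltcR.
move=> w zw; apply: eU; rewrite /ball/= -ltcR; apply: le_lt_trans zw.
by rewrite norm_sqnorm sqnormB lecR -sqrtr_sqr ler_wsqrtr// lerDr sqr_ge0.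
Qed.

Lemma sqnorm_continuous : continuous sqnorm.
Proof.
move=> z; rewrite /sqnorm; under eq_fun do rewrite !expr2.
apply: (@cvgD R R C (nbhs z) _ (fun z => complex.Re z * complex.Re z)
    (fun z => complex.Im z * complex.Im z)).
  by apply: (@continuousM R C (@complex.Re R) (@complex.Re R)); exact: Re_continuous.
by apply: (@continuousM R C (@complex.Im R) (@complex.Im R)); exact: Im_continuous.
Qed.

Lemma cis_continuous : continuous cis.
Proof.
move=> t U /complex_near[e e0 eU].
have ct : {for t, continuous (fun t : R => cos (pi *+ 2 * t))}.
  apply: continuous_comp; last exact: continuous_cos.
  by apply: cvgM; [exact: cvg_cst|exact: cvg_id].
have st : {for t, continuous (fun t : R => sin (pi *+ 2 * t))}.
  apply: continuous_comp; last exact: continuous_sin.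
  by apply: cvgM; [exact: cvg_cst|exact: cvg_id].
move/cvgrPdist_lt : ct => /(_ _ e0) ct; move/cvgrPdist_lt : st => /(_ _ e0) st.
near=> s; apply: eU => /=; near: s.
  exact: ct.
exact: st.
Unshelve. all: by end_near.
Qed.

Definition circle_param (t : R) : S2 := Some (cis t).

Lemma measurable_circle_param :
  measurable_fun setT (circle_param : measurableTypeR R -> B).
Proof.
apply: measurable_fun_sphere => O opO; apply: measurable_realfun.open_measurable.
apply: (@open_comp _ _ circle_param) => // t _.
apply: continuous_comp; first exact: cis_continuous.
exact: one_point_compactification_some_continuous.
Qed.

Lemma monomial_circle_param (a t : R) n :
  monomial (cis a) n (circle_param t) = circle_param (t *+ n + a).
Proof.
by rewrite /circle_param monomial_Some -cisMn -cisD addrC.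
Qed.

End SphereBorel.

Notation pushforward_measure :=
  measure_function_pushforward__canonical__measure_function_Measure.

(** * Lebesgue measure of periodic sets *)

Section LebesgueCircle.
Variable R : realType.
Local Notation leb := (@lebesgue_measure R).

Lemma measurable_affine (a b : R) :
  measurable_fun setT ((fun t => a * t + b) : measurableTypeR R -> measurableTypeR R).
Proof. by apply: measurable_funD => //; exact: measurable_funM. Qed.

(** The pushforward by t |-> a t + b, multiplied by a, agrees with Lebesgue measure on half-open
    intervals, and these determine it. *)
Lemma lebesgue_affine (a b : R) (A : set (measurableTypeR R)) : 0 < a -> measurable A ->
  leb ((fun t => a * t + b) @^-1` A) = ((a^-1)%:E * leb A)%E.
Proof.
move=> a0 mA; pose f : measurableTypeR R -> measurableTypeR R := fun t => a * t + b.
have mf : measurable_fun setT f := measurable_affine a b.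
suff -> : leb A = mscale (NngNum (ltW a0)) (pushforward_measure leb mf) A.
  rewrite -[X in (_ * X)%E]/((a%:E * leb (f @^-1` A))%E).
  by rewrite muleA -EFinM mulVf ?gt_eqF// mul1e.
apply: lebesgue_measure_unique => // _ [[x y] _ <-].
rewrite -[RHS]/((a%:E * leb (f @^-1` `]x, y]))%E).
have -> : f @^-1` [set` `]x, y]] = [set` `](x - b) / a, (y - b) / a]].
  apply/seteqP; split=> t /=; rewrite !in_itv/= /f ltr_pdivrMr// ler_pdivlMr//.
    by rewrite ltrBlDr lerBrDr mulrC.
  by rewrite ltrBlDr lerBrDr mulrC.
rewrite !lebesgue_measure_itv/= !lte_fin ltr_pM2r ?invr_gt0// ltrD2r.
case: ifP => _; last by rewrite mule0.
rewrite -EFinB -EFinM -mulrBl mulrC divfK ?gt_eqF//; congr EFin; ring.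
Qed.

Variable A : set (measurableTypeR R).
Hypothesis mA : measurable A.
Hypothesis perA : forall t, A (t + 1) <-> A t.

Let G x : \bar R := leb (A `&` `[0, x[).

Let mI x y : measurable (A `&` `[x, y[ : set (measurableTypeR R)).
Proof. exact: measurableI. Qed.

Let split_itv x y z : x <= y -> y <= z ->
  leb (A `&` `[x, z[) = (leb (A `&` `[x, y[) + leb (A `&` `[y, z[))%E.
Proof.
move=> xy yz; rewrite -measureU//; last first.
  apply/seteqP; split=> // t [[_ /=]] + [_ /=]; rewrite !in_itv/= => /andP[_ ty] /andP[yt _].
  by have := lt_le_trans ty yt; rewrite ltxx.
congr leb; apply/seteqP; split=> t /=; rewrite !in_itv/=.
  move=> [At /andP[xt tz]]; have [ty|yt] := ltP t y; [left|right]; split=> //; exact/andP.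
move=> [[At /andP[xt ty]]|[At /andP[yt tz]]]; split=> //; apply/andP; split=> //.
  exact: lt_le_trans yz.
exact: le_trans yt.
Qed.

Let shift1 x y : leb (A `&` `[x + 1, y + 1[) = leb (A `&` `[x, y[).
Proof.
have := @lebesgue_affine 1 1 _ ltr01 (mI (x + 1) (y + 1)).
rewrite invr1 mul1e => <-; congr leb; apply/seteqP; split=> t /=.
  by rewrite mul1r !in_itv/= => -[/perA At]; rewrite lerD2r ltrD2r.
by rewrite mul1r !in_itv/= => -[/perA At]; rewrite lerD2r ltrD2r.
Qed.

Let shiftn x y n : leb (A `&` `[x + n%:R, y + n%:R[) = leb (A `&` `[x, y[).
Proof.
elim: n => [|n IH]; first by rewrite !addr0.
by rewrite -natr1 !addrA shift1.
Qed.

Let fin_G x : G x \is a fin_num.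
Proof.
rewrite ge0_fin_numE ?measure_ge0//.
apply: (@le_lt_trans _ _ (leb `[0, x[)).
  by apply: le_measure; rewrite ?inE//; exact: subIsetr.
by rewrite lebesgue_measure_itv/=; case: ifP => _; rewrite ?ltry.
Qed.

Let Gn n : G n%:R = (n%:R%:E * G 1)%E.
Proof.
elim: n => [|n IH].
  by rewrite mul0e /G set_itvco0 setI0 measure0.
rewrite [LHS](@split_itv _ n%:R) ?ler0n ?ler_nat//.
rewrite -[leb (A `&` `[0, n%:R[)]/(G n%:R) IH -natr1 EFinD muleDl ?fin_num_adde_defl ?fin_G//.
by rewrite mul1e; congr (_ + _)%E; rewrite -[RHS](shiftn 0 1 n) add0r addrC.
Qed.

(** The substitution t |-> n t + a carries [0, 1[ to [a, n + a[. By periodicity A has n times its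
    mass on [0, 1[ there, and the Jacobian divides by n. *)
Lemma lebesgue_periodic (a : R) n : 0 <= a -> (0 < n)%N ->
  leb ([set t | A (n%:R * t + a)] `&` `[0, 1[) = leb (A `&` `[0, 1[).
Proof.
move=> a0 n0; have n0R : 0 < n%:R :> R by rewrite ltr0n.
have -> : [set t | A (n%:R * t + a)] `&` `[0, 1[ =
    (fun t => n%:R * t + a) @^-1` (A `&` `[a, n%:R + a[).
  apply/seteqP; split=> t /=; rewrite !in_itv/= => -[At /andP[t0 t1]]; split=> //.
    by rewrite lerDr mulr_ge0 ?ler0n//= ltrD2r -[ltRHS]mulr1 ltr_pM2l.
  move: t0 t1; rewrite lerDr ltrD2r -[X in _ < X -> _]mulr1 ltr_pM2l// pmulr_rge0//.
  by move=> -> ->.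
rewrite lebesgue_affine//.
suff -> : leb (A `&` `[a, n%:R + a[) = (n%:R%:E * G 1)%E.
  by rewrite muleA -EFinM mulVf ?gt_eqF// mul1e.
(* Cutting [0, n + a[ at a and at n gives two expressions for its mass. The pieces [0, a[ and [n, n
   + a[ have the same finite mass G a, which cancels. *)
have E1 : G (n%:R + a) = (leb (A `&` `[a, (n%:R + a)%R[) + G a)%E.
  by rewrite /G (@split_itv 0 a) ?lerDr ?ler0n// addeC.
have E2 : G (n%:R + a) = (n%:R%:E * G 1 + G a)%E.
  rewrite /G (@split_itv 0 n%:R) ?ler0n ?lerDl// -/(G n%:R) Gn; congr (_ + _)%E.
  by rewrite -[RHS](shiftn 0 a n) add0r addrC.
by rewrite -(addeK (leb _) (fin_G a)) -E1 E2 addeK.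
Qed.

Lemma lebesgue_half_periodic :
  leb ([set t | A (2 * t)] `&` `[0, 2^-1[) = ((2^-1)%:E * leb (A `&` `[0%R, 1%R[))%E.
Proof.
have -> : [set t | A (2 * t)] `&` `[0, 2^-1[ =
    (fun t => 2 * t + 0) @^-1` (A `&` `[0, 1[).
  apply/seteqP; split=> t /=; rewrite !in_itv/= addr0 => -[At /andP[t0 t1]]; split=> //.
    by rewrite mulr_ge0//= mulrC -ltr_pdivlMr// div1r.
  by move: t0 t1; rewrite pmulr_rge0// => -> /=; rewrite mulrC -ltr_pdivlMr// div1r.
by rewrite lebesgue_affine.
Qed.

End LebesgueCircle.

(** * Lebesgue measure on the unit circle *)

Section CircleMeasure.
Variable R : realType.
Local Notation C := (Cplx R).
Local Notation S2 := (sphere R).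
Local Notation B := (Borel R).
Local Notation leb := (@lebesgue_measure R).

(** The pushforward of Lebesgue measure on [0, 1[ by [circle_param] is written out so that it
    unfolds to a length; its measure axioms are those of the pushforward [mcirc] below. *)
Definition circle_measure (A : set B) : \bar R :=
  leb (@circle_param R @^-1` A `&` `[0, 1[).

Let mitv : measurable (`[0, 1[%classic : set (measurableTypeR R)).
Proof. exact: measurable_itv. Qed.

Let mcirc := pushforward_measure (mrestr leb mitv) (@measurable_circle_param R).

HB.instance Definition _ := isMeasure.Build _ _ _ circle_measure
  (measure0 mcirc) (measure_ge0 mcirc) (@measure_semi_sigma_additive _ _ _ mcirc).

Let circle_measureT : circle_measure setT = 1%E.
Proof.
by rewrite /circle_measure preimage_setT setTI lebesgue_measure_itv/= lte_fin ltr01 oppr0 adde0.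
Qed.

HB.instance Definition _ :=
  Measure_isProbability.Build _ _ _ circle_measure circle_measureT.

Lemma measurable_circle_preimage (A : set B) : measurable A ->
  measurable (@circle_param R @^-1` A : set (measurableTypeR R)).
Proof. by move=> mA; rewrite -[X in measurable X]setTI; exact: measurable_circle_param. Qed.

Lemma circle_paramD1 (t : R) : circle_param (t + 1) = circle_param t.
Proof. by rewrite /circle_param cisD cis1 mulr1. Qed.

(** In the angular parameter the map is t |-> n t + a, and preimages under [circle_param] are
    1-periodic. *)
Lemma circle_measure_monomial (a : R) n (A : set B) : 0 <= a -> (0 < n)%N ->
  measurable A -> circle_measure (monomial (cis a) n @^-1` A) = circle_measure A.
Proof.
move=> a0 n0 mA; rewrite /circle_measure.
rewrite -[RHS](@lebesgue_periodic R _ (measurable_circle_preimage mA) _ a n)//.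
  congr leb; congr (_ `&` _); apply/seteqP; split=> t /=;
  by rewrite monomial_circle_param mulr_natl.
by move=> t /=; rewrite circle_paramD1.
Qed.

(** The half plane is half-open, with the positive but not the negative real axis, so that on the
    circle it matches exactly the parameters in [0, 1/2[. *)
Definition upper : set S2 :=
  [set x | if x is Some z
     then 0 < complex.Im z \/ (complex.Im z = 0 /\ 0 < complex.Re z) else False].

Lemma cis_upper (t : R) : 0 <= t -> t < 1 -> upper (circle_param t) <-> t < 2^-1.
Proof.
move=> t0 t1; rewrite /upper/=; set x := pi *+ 2 * t.
have pi0 := @pi_gt0 R.
have x0 : 0 <= x by rewrite mulr_ge0// mulrn_wge0// ltW.
split=> [H|th].
  rewrite ltNge; apply/negP => ht.
  have xE : x = (x - pi) + pi by rewrite subrK.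
  have y0 : 0 <= x - pi.
    have h2 : 0 <= 2 * t - 1 by lra.
    by have := mulr_ge0 (ltW pi0) h2; rewrite /x -mulr_natr; lra.
  have y1 : x - pi < pi.
    by rewrite ltrBlDr -mulr2n /x -[ltRHS]mulr1 ltr_pM2l// mulrn_wgt0.
  have := @sinDpi R (x - pi); rewrite -xE => sE; have := @cosDpi R (x - pi); rewrite -xE => cE.
  have : 0 <= sin (x - pi) by apply: sin_ge0_pi; rewrite y0 ltW.
  case: H => [|[s0 c0]]; first by rewrite sE oppr_gt0 => /lt_le_trans h /h; rewrite ltxx.
  have [y00|yn] := eqVneq (x - pi) 0.
    by move: c0; rewrite cE y00 cos0 oppr_gt0 ltr10.
  have : 0 < sin (x - pi) by apply: sin_gt0_pi; rewrite lt_neqAle eq_sym yn y0.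
  by rewrite -[sin _]opprK -sE s0 oppr0 ltxx.
have [t00|tn] := eqVneq t 0.
  by right; rewrite /x t00 mulr0 sin0 cos0.
left; apply: sin_gt0_pi.
have t2 : 0 < t by rewrite lt_neqAle eq_sym tn.
have h1 := mulr_gt0 pi0 t2.
have h2 : 0 < 1 - 2 * t by lra.
have := mulr_gt0 pi0 h2; rewrite /x -mulr_natr => h3; apply/andP; split; lra.
Qed.

Lemma measurable_upper : measurable (upper : set B).
Proof.
pose M (h : C -> R) : set B := [set Some z | z in [set z | 0 < h z]].
have mM (h : C -> R) : continuous h -> measurable (M h).
  move=> ch; apply: measurable_Some.
  by apply: (@open_comp _ _ h [set y | 0 < y]) => [? _|]; [exact: ch|exact: open_gt].
have -> : upper = M (@complex.Im R) `|`
    (M (@complex.Re R) `\` M (fun z => - complex.Im z)).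
  apply/seteqP; split=> [[z|]//=|x].
    move=> [h|[h1 h2]]; [by left; exists z|right; split; first by exists z].
    by move=> [w /= + [wz]]; rewrite wz h1 oppr0 ltxx.
  move=> [[z /= zp <-]|[[z /= zp <-] h]]; first by left.
  have [z0|z0|z0] := ltgtP 0 (complex.Im z); [by left| |by right].
  by exfalso; apply: h; exists z => //=; rewrite oppr_gt0.
apply: measurableU; first by apply: mM; exact: Im_continuous.
apply: measurableD; apply: mM; first exact: Re_continuous.
by move=> z; apply: (@continuousN R R C); exact: Im_continuous.
Qed.

(** On [0, 1/2[ squaring is t |-> 2 t, onto [0, 1[. This says that the half plane of a point is
    independent of the position of its square. *)
Lemma circle_measure_upper (A : set B) : measurable A ->
  circle_measure (upper `&` monomial (1 : C) 2 @^-1` A) =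
  ((2^-1)%:E * circle_measure A)%E.
Proof.
move=> mA; rewrite /circle_measure.
rewrite -(@lebesgue_half_periodic R _ (measurable_circle_preimage mA)).
congr leb; apply/seteqP; split=> t /=; rewrite !in_itv/= -(@cis0 R) monomial_circle_param
    mulr_natl addr0.
  by move=> [[ut At] /andP[t0 t1]]; split=> //; rewrite t0; exact/cis_upper.
move=> [At /andP[t0 th]]; rewrite t0/=.
have t1 : t < 1 by rewrite (lt_trans th)// invf_lt1// ltr1n.
by split=> //; split=> //; exact/(cis_upper t0).
Qed.

Lemma circle_measure_points :
  circle_measure ([set None] `|` [set Some 0]) = 0%E.
Proof.
rewrite /circle_measure (_ : _ `&` _ = set0) ?measure0//.
apply/seteqP; split=> // t [[//|ct] _].
have {}ct : cis t = 0 by exact: (congr1 (@chart0 R) ct).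
by have := norm_cis t; rewrite ct normr0 => /eqP; rewrite eq_sym oner_eq0.
Qed.

End CircleMeasure.

(** * The Lyubich operator of a monomial *)

Section MonomialFibres.
Variable R : realType.
Local Notation C := (Cplx R).
Local Notation S2 := (sphere R).

Lemma cos_eq1 (x : R) : 0 <= x -> x <= pi -> cos x = 1 -> x = 0.
Proof.
move=> x0 x1 cx; apply: (@cos_inj R); last by rewrite cos0.
  by rewrite in_itv/= x0.
by rewrite in_itv/= lexx pi_ge0.
Qed.

Lemma cis_eq1 (t : R) : 0 <= t -> t < 1 -> cis t = 1 -> t = 0.
Proof.
move=> t0 t1 ct; have pi0 := @pi_gt0 R.
have c1 : cos (pi *+ 2 * t) = 1 by exact: (congr1 (@complex.Re R) ct).
have [th|th] := lerP t 2^-1.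
  have h1 := mulr_ge0 (ltW pi0) t0; have h3 : 0 <= 1 - 2 * t by lra.
  have h2 := mulr_ge0 (ltW pi0) h3.
  have /eqP : pi *+ 2 * t = 0 by apply: cos_eq1 => //; rewrite -mulr_natr; lra.
  by rewrite mulf_eq0 mulrn_eq0/= gt_eqF//= => /eqP.
have t2 : 0 < 1 - t by lra.
have h1 := mulr_gt0 pi0 t2; have h3 : 0 <= 2 * t - 1 by lra.
have h2 := mulr_ge0 (ltW pi0) h3.
have /eqP : pi *+ 2 * (1 - t) = 0.
  apply: cos_eq1; [by rewrite -mulr_natr; lra|by rewrite -mulr_natr; lra|].
  by rewrite mulrBr mulr1 cosB cos2pi sin2pi mul1r mul0r addr0.
by rewrite mulf_eq0 mulrn_eq0/= gt_eqF//= => /eqP; lra.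
Qed.

Lemma cis_prim n : (0 < n)%N -> n.-primitive_root (cis (n%:R^-1 : R)).
Proof.
move=> n0; apply/andP; split=> //; apply/forallP => i; apply/eqP.
have n0R : 0 < n%:R :> R by rewrite ltr0n.
have [->|ni] := eqVneq i.+1 n.
  by apply/unity_rootP; rewrite -cisMn -[X in cis X]mulr_natr mulVf ?gt_eqF// cis1.
apply/negP => /unity_rootP; rewrite -cisMn -[X in cis X]mulr_natr mulrC => h.
have iR : 0 < i.+1%:R :> R by rewrite ltr0n.
suff /eqP : i.+1%:R / n%:R = 0 :> R by rewrite mulf_eq0 invr_eq0 !gt_eqF.
apply: cis_eq1 => //.
by rewrite ltr_pdivrMr// mul1r ltr_nat ltn_neqAle ni ltn_ord.
Qed.

Variables (c : C) (n : nat).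
Hypotheses (c0 : c != 0) (n0 : (0 < n)%N).
Let om : C := cis (n%:R^-1 : R).

Lemma monomial_size_gt1 : (1 < size (c *: 'X^n : {poly C}))%N.
Proof. by rewrite size_monomial. Qed.

Lemma deg_monomial : deg (monomial c n) = n.
Proof. by rewrite /monomial deg_poly ?monomial_size_gt1// size_monomial. Qed.

(** Up to a constant, F is X ^ n - z ^ n, whose derivative n z ^ (n - 1) at z is nonzero; a double
    root would make it vanish. *)
Lemma mult_monomial (z : C) : z != 0 -> mult (monomial c n) (Some z) = 1%N.
Proof.
move=> z0; have [k k0 kE] := frac_poly monomial_size_gt1.
rewrite /mult [frac _]kE monomial_Some.
set F := k *: _ - _.
have FE : F = (k * c) *: ('X^n - (z ^+ n)%:P).
  rewrite /F scalerA scalerBr; congr (_ - _).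
  by rewrite -!mul_polyC -!polyCM; congr (_%:P); ring.
have F0 : F != 0.
  rewrite FE scaler_eq0 negb_or mulf_neq0//= -size_poly_gt0.
  by rewrite size_XnsubC//.
have rF : root F z by rewrite FE rootE !hornerE subrr mulr0.
apply/eqP; rewrite eqn_leq mup_geq// mup_leq// expr1 dvdp_XsubCl rF andbT.
apply/negP => /dvdpP[H HE].
have : F^`().[z] = 0.
  by rewrite HE expr2 mulrA !derivM derivXsubC !hornerE subrr ?(mulr0, mul0r, addr0, add0r).
rewrite FE derivZ derivB derivC subr0 derivXn !hornerE hornerMn !hornerE => /eqP.
rewrite -mulr_natr !mulf_eq0 (negbTE k0) (negbTE c0) expf_eq0 (negbTE z0) andbF/=.
by rewrite pnatr_eq0 eqn0Ngt n0.
Qed.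

Lemma monomial_fibre (z : C) : z != 0 ->
  monomial c n @^-1` [set Some (c * z ^+ n)] =
  [set` [seq Some (om ^+ j * z) : S2 | j <- iota 0 n]].
Proof.
move=> z0; have omP := cis_prim n0; apply/seteqP; split=> [[w|]|x] /=.
- rewrite monomial_Some => -[/(mulfI c0) wz].
  have [|j wE] := @prim_rootP _ n om omP (w / z).
    by rewrite exprMn exprVn wz divff// expf_neq0.
  apply/mapP; exists (val j); first by rewrite mem_iota/= add0n.
  by rewrite -wE divfK.
- by rewrite monomial_None.
move=> /mapP[j _ ->]; rewrite monomial_Some exprMn exprAC.
by rewrite (prim_expr_order omP) expr1n mul1r.
Qed.

Lemma lyubich_monomial (phi : S2 -> C) (z : C) : z != 0 ->
  lyubich (monomial c n) phi (Some (c * z ^+ n)) =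
  n%:R^-1 * \sum_(0 <= j < n) phi (Some (om ^+ j * z)).
Proof.
move=> z0; have omP := cis_prim n0.
rewrite /lyubich deg_monomial monomial_fibre//; congr (_ * _).
rewrite -(@fsbig_seq _ _ _ _ [seq Some (om ^+ j * z) : S2 | j <- iota 0 n])/=.
  rewrite big_map /index_iota subn0; apply: eq_bigr => j _.
  rewrite mult_monomial ?mul1r// mulf_neq0// expf_neq0//.
  by rewrite -normr_eq0 norm_cis oner_eq0.
rewrite map_inj_in_uniq ?iota_uniq// => i j; rewrite !mem_iota !add0n /= => ni nj.
move=> [/(mulIf z0) /eqP]; rewrite (eq_prim_root_expr omP).
by rewrite !modn_small// => /eqP.
Qed.

End MonomialFibres.

(** * Measurability of functions known along the fibres of a monomial *)

Section FibreMeasurability.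
Variable R : realType.
Local Notation C := (Cplx R).
Local Notation S2 := (sphere R).
Local Notation B := (Borel R).

Definition box (N : nat) : set C :=
  [set (xy.1 +i* xy.2)%C | xy in `[- N%:R, N%:R : R] `*` `[- N%:R, N%:R : R]].

Lemma box_compact N : compact (box N).
Proof.
apply: continuous_compact; last by apply: compact_setX; exact: segment_compact.
apply: continuous_subspaceT => -[x y] U /complex_near[e e0 eU].
exists (ball x e, ball y e) => /=; first by split; exact: nbhsx_ballx.
by move=> [x' y'] [/= hx hy]; apply: eU.
Qed.

Lemma mem_box (z : C) N :
  `|complex.Re z| <= N%:R -> `|complex.Im z| <= N%:R -> box N z.
Proof.
rewrite !ler_norml => hx hy; exists (complex.Re z, complex.Im z).
  by split; rewrite /= in_itv/=.
by case: (z).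
Qed.

(* Away from 0, the set {h >= x} is the image under z |-> c z ^ n of a closed
   set, hence a countable union of compact sets. *)
Lemma fibre_measurable (c : C) n (h : B -> R) (k : C -> R) :
  c != 0 -> (0 < n)%N -> continuous k ->
  (forall z, z != 0 -> h (Some (c * z ^+ n)) = k z) ->
  measurable_fun setT h.
Proof.
move=> c0 n0 kc hk.
apply: (@measurable_fun_from_sphere _ _ _ _ _ (RGenCInfty.measurableE R)).
move=> _ [x ->]; set T := [set Some z | z in _].
(* The boxes with a neighbourhood of 0 removed are compact and exhaust the nonzero numbers. *)
pose A N := box N `&` [set z | N.+1%:R^-1 <= sqnorm z] `&` [set z | x <= k z].
have cA N : compact (A N).
  apply: compact_closedI; first apply: compact_closedI; first exact: box_compact.
    by apply: (@closed_comp _ _ (@sqnorm R) [set y | N.+1%:R^-1 <= y]);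
      [by move=> ? _; exact: sqnorm_continuous|exact: closed_ge].
  by apply: (@closed_comp _ _ k [set y | x <= y]) ; [by move=> ? _; exact: kc|exact: closed_ge].
pose Q (z : C) := c * z ^+ n.
have cQ N : closed (Q @` A N).
  apply: compact_closed; first exact: norm_hausdorff.
  apply: continuous_compact => //; apply: continuous_subspaceT.
  exact: monomial_continuous.
have sub : \bigcup_N [set Some z | z in Q @` A N] `<=` T.
  move=> _ [N _ [_ [z [[_ /= zs] zx] <-] <-]].
  have z0 : z != 0.
    apply/eqP => z0; move: zs; rewrite z0 sqnorm0 leNgt invr_gt0 ltr0n//.
  by exists (Q z) => //=; rewrite in_itv/= andbT hk.
have cover w : w != 0 -> x <= h (Some w) -> (\bigcup_N [set Some z | z in Q @` A N]) (Some w).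
  move=> w0 xw; pose z : C := n.-root ((w / c) : R[i]).
  have zn : z ^+ n = w / c by exact: (@rootCK R[i] n n0).
  have zw : Q z = w by rewrite /Q zn mulrC divfK.
  have z0 : z != 0.
    by apply/eqP => z0; move: w0; rewrite -zw /Q z0 expr0n eqn0Ngt n0 mulr0 eqxx.
  pose b := `|complex.Re z| + `|complex.Im z| + (sqnorm z)^-1.
  have sV : 0 < (sqnorm z)^-1 by rewrite invr_gt0 sqnorm_gt0.
  have b0 : 0 <= b by rewrite !addr_ge0// ltW.
  have bN := archi_boundP b0; set N := Num.bound b in bN.
  exists N => //; exists w => //; exists z => //; split; first split.
  - apply: mem_box; apply: le_trans (ltW bN).
      by rewrite /b -addrA lerDl addr_ge0// ltW.
    by rewrite /b addrAC lerDr addr_ge0// ltW.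
  - rewrite /= -[sqnorm z]invrK lef_pV2 ?posrE ?ltr0n//.
    rewrite -natr1; apply: ler_wpDr => //; apply: le_trans (ltW bN).
    by rewrite /b lerDr addr_ge0.
  - by rewrite /= -hk// -/(Q z) zw.
have mU : measurable (\bigcup_N [set Some z | z in Q @` A N] : set B).
  by apply: bigcup_measurable => N _; exact: measurable_Some_closed.
(* The hypothesis on h says nothing about its value at 0, so that point is added to the union or
   not, as the case may be. *)
have [h0|h0] := pselect (x <= h (Some 0)).
  have -> : T = \bigcup_N [set Some z | z in Q @` A N] `|` [set Some z | z in [set 0]].
    apply/seteqP; split=> [_ [w /= + <-]|_ [/sub//|[w /= -> <-]]].
      rewrite in_itv/= andbT => hw; have [->|w0] := eqVneq w 0.
        by right; exists 0.
      by left; exact: cover.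
    by exists 0 => //=; rewrite in_itv/= andbT.
  apply: measurableU => //; apply: measurable_Some_closed.
  by apply: compact_closed; [exact: norm_hausdorff|exact: compact_set1].
suff -> : T = \bigcup_N [set Some z | z in Q @` A N] by [].
apply/seteqP; split=> // _ [w /= + <-]; rewrite in_itv/= andbT => hw.
apply: cover => //; apply: contra_notN h0 => /eqP <- //.
Qed.

End FibreMeasurability.

(** * Invariance of the circle measure under Lyubich operators *)

Section LyubichCircle.
Variable R : realType.
Local Notation C := (Cplx R).
Local Notation S2 := (sphere R).
Local Notation B := (Borel R).
Local Notation m := (@circle_measure R).

Lemma bounded_integrable (g : B -> R) (K : R) : measurable_fun setT g ->
  (forall x, `|g x| <= K) -> m.-integrable setT (EFin \o g).
Proof.
move=> mg gK; apply: measurable_bounded_integrable => //.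
  by rewrite (le_lt_trans (probability_le1 _ _)) ?ltry.
by exists K; split; [exact: num_real|move=> y Ky x _ /=; exact: le_trans (gK x) (ltW Ky)].
Qed.

Lemma Rintegral_monomial (a : R) n (g : B -> R) (K : R) : 0 <= a -> (0 < n)%N ->
  measurable_fun setT g -> (forall x, `|g x| <= K) ->
  Rintegral m setT (g \o monomial (cis a) n) = Rintegral m setT g.
Proof.
move=> a0 n0 mg gK; have mQ := @measurable_monomial R (cis a) n.
rewrite /Rintegral; congr fine.
rewrite [RHS](@eq_measure_integral _ B R setT (pushforward_measure m mQ)); last first.
  by move=> A mA _; rewrite -[LHS](circle_measure_monomial a0 n0 mA).
rewrite (integral_pushforward mQ)//.
- exact/measurable_EFinP.
- rewrite preimage_setT; apply: (@bounded_integrable _ K) => [|x]; last exact: gK.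
  exact: (measurableT_comp mg mQ).
Qed.

(** The circle measure does not charge 0 and infinity. *)
Lemma Rintegral_ae (f g : B -> R) : measurable_fun setT f -> measurable_fun setT g ->
  (forall z : C, z != 0 -> f (Some z) = g (Some z)) ->
  Rintegral m setT f = Rintegral m setT g.
Proof.
move=> mf mg fg; rewrite /Rintegral; congr fine; apply: ae_eq_integral => //.
- exact/measurable_EFinP.
- exact/measurable_EFinP.
exists ([set None] `|` [set Some 0]); split.
- apply: measurableU; first exact: measurable_infty.
  exact: measurable_point.
- exact: circle_measure_points.
- move=> [z|] /= nE; last by left.
  right; apply: contrapT => z0; apply: nE => _; congr EFin; apply: fg.
  by apply/eqP => zz; apply: z0; rewrite zz.
Qed.

Lemma Rintegral_sum (g : nat -> B -> R) (K : R) n :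
  (forall j, measurable_fun setT (g j)) -> (forall j x, `|g j x| <= K) ->
  Rintegral m setT (fun x => \sum_(0 <= j < n) g j x) =
  \sum_(0 <= j < n) Rintegral m setT (g j).
Proof.
move=> mg gK; elim: n => [|n IH].
  rewrite big_nil -[RHS](_ : Rintegral m setT (cst 0) = 0); last first.
    by rewrite /Rintegral integral0.
  by apply: eq_Rintegral => x _; rewrite big_nil.
under eq_Rintegral do rewrite big_nat_recr//=.
rewrite RintegralD// ?IH ?big_nat_recr//; last exact: (@bounded_integrable _ K).
apply: (@bounded_integrable _ (K *+ n)).
  by under eq_fun do rewrite big_mkord; apply: measurable_sum.
move=> x; apply: le_trans (ler_norm_sum _ _ _) _.
apply: le_trans (ler_sum _ (fun j _ => gK j x)) _.
by rewrite big_const_nat subn0 iter_addr_0.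
Qed.

Lemma continuous_bounded (u : S2 -> R) : continuous u ->
  exists K : R, forall x, `|u x| <= K.
Proof.
move=> cu; have : compact (u @` setT).
  apply: continuous_compact; last exact: one_point_compactification_compact.
  exact: continuous_subspaceT.
move=> /compact_bounded[K [_ hK]]; exists (K + 1) => x.
by apply: (hK (K + 1)); [rewrite ltrDl|exists x].
Qed.

Lemma continuous_measurable_sphere (u : S2 -> R) : continuous u ->
  measurable_fun setT (u : B -> R).
Proof.
move=> cu; apply: (@measurability _ _ B _ setT u _ (RGenOInfty.measurableE R)).
move=> _ [_ [x ->] <-]; rewrite setTI; apply: open_measurable_sphere.
by apply: open_comp => [? _|]; [exact: cu|exact: interval_open].
Qed.

Lemma continuous_sum (s : seq nat) (f : nat -> C -> R) :
  (forall j, continuous (f j)) -> continuous (fun z => \sum_(j <- s) f j z).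
Proof.
move=> cf; elim: s => [|j s IH].
  rewrite (_ : (fun z => _) = cst 0); first exact: cst_continuous.
  by apply/funext => z; rewrite big_nil.
rewrite (_ : (fun z => _) = (fun z => f j z + \sum_(i <- s) f i z)); last first.
  by apply/funext => z; rewrite big_cons.
by move=> z; apply: (@continuousD R R C (f j)); [exact: cf|exact: IH].
Qed.

(** Let Q be the monomial cis(a) z ^ n. By invariance the integral of h is that of h o Q, which is
    the average of u over n rotations, and each rotation preserves the measure. The function h
    stands for the real or the imaginary part of a Lyubich transform. *)
Lemma Rintegral_lyubich (a : R) n (h u : S2 -> R) : 0 <= a -> (0 < n)%N ->
  continuous u ->
  (forall z : C, z != 0 -> h (Some (cis a * z ^+ n)) =
     n%:R^-1 * \sum_(0 <= j < n) u (Some (cis (n%:R^-1 : R) ^+ j * z))) ->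
  Rintegral m setT (h : B -> R) = Rintegral m setT (u : B -> R).
Proof.
move=> a0 n0 cu hE; have n0R : n%:R != 0 :> R by rewrite pnatr_eq0 -lt0n.
have c0 : cis a != 0 by rewrite -normr_eq0 norm_cis oner_eq0.
have [K uK] := continuous_bounded cu.
have mu := continuous_measurable_sphere cu.
pose rot j := monomial (cis (n%:R^-1 *+ j : R)) 1.
pose g j : B -> R := u \o rot j.
pose k (z : C) := n%:R^-1 * \sum_(0 <= j < n) u (Some (cis (n%:R^-1 : R) ^+ j * z)).
have mg j : measurable_fun setT (g j).
  exact: (measurableT_comp mu (@measurable_monomial R _ _)).
have gK j x : `|g j x| <= K by exact: uK.
have kK z : `|k z| <= K.
  rewrite normrM normfV normr_nat ler_pdivrMl ?ltr0n//.
  apply: le_trans (ler_norm_sum _ _ _) _.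
  apply: le_trans (ler_sum _ (fun j _ => uK _)) _.
  by rewrite big_const_nat subn0 iter_addr_0 mulr_natl.
have kc : continuous k.
  move=> z; apply: (@continuousM R C (fun=> n%:R^-1)); first exact: cst_continuous.
  apply: continuous_sum => j w.
  apply: (@continuous_comp C S2 R (fun z => Some (cis n%:R^-1 ^+ j * z)) u); last exact: cu.
  apply: (@continuous_comp C C S2 ( *%R (cis n%:R^-1 ^+ j)) Some).
    exact: mulrl_continuous.
  exact: one_point_compactification_some_continuous.
have mh : measurable_fun setT (h : B -> R) := fibre_measurable c0 n0 kc hE.
(* Away from 0 and infinity h is an average of values of u; its two remaining values are simply
   added to the bound. *)
pose H := K + `|h (Some 0)| + `|h None|.
have K0 : 0 <= K := le_trans (normr_ge0 _) (uK None).
have hH x : `|h x| <= H.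
  case: x => [w|]; last by rewrite /H lerDr addr_ge0.
  have [->|w0] := eqVneq w 0; first by rewrite /H addrAC lerDr addr_ge0.
  pose z : C := n.-root ((w / cis a) : R[i]).
  have zn : z ^+ n = w / cis a by exact: (@rootCK R[i] n n0).
  have zw : cis a * z ^+ n = w by rewrite zn mulrC divfK.
  have z0 : z != 0.
    by apply/eqP => z0; move: w0; rewrite -zw z0 expr0n eqn0Ngt n0 mulr0 eqxx.
  by rewrite -zw hE// (le_trans (kK z))// /H -addrA lerDl addr_ge0.
rewrite -(Rintegral_monomial a0 n0 mh hH).
have mk : measurable_fun setT (fun x : B => n%:R^-1 * \sum_(0 <= j < n) g j x).
  apply: measurable_funM => //.
  by under eq_fun do rewrite big_mkord; apply: measurable_sum.
rewrite (@Rintegral_ae _ (fun x => n%:R^-1 * \sum_(0 <= j < n) g j x))//.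
- rewrite RintegralZl//; last first.
    apply: (@bounded_integrable _ (K *+ n)).
      by under eq_fun do rewrite big_mkord; apply: measurable_sum.
    move=> x; apply: le_trans (ler_norm_sum _ _ _) _.
    apply: le_trans (ler_sum _ (fun j _ => gK j x)) _.
    by rewrite big_const_nat subn0 iter_addr_0.
  rewrite (@Rintegral_sum _ K)//.
  under eq_bigr => j _ do rewrite /g (@Rintegral_monomial _ _ _ K) ?mulrn_wge0 ?invr_ge0//.
  by rewrite big_const_nat subn0 iter_addr_0 -[X in _ * X]mulr_natl mulrA mulVf// mul1r.
- exact: (measurableT_comp mh (@measurable_monomial R _ _)).
- move=> z z0; rewrite /= monomial_Some hE//; congr (_ * _); apply: eq_bigr => j _.
  by rewrite /g/rot/= monomial_Some expr1 cisMn.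
Qed.

Lemma lyubich_fixed_monomial (a : R) n : 0 <= a -> (0 < n)%N ->
  lyubich_fixed (monomial (cis a) n) m.
Proof.
move=> a0 n0 phi cphi; rewrite /lyubich_dual /cintegral.
have c0 : cis a != 0 by rewrite -normr_eq0 norm_cis oner_eq0.
have sumE (s : seq nat) (f : nat -> C) : let S := \sum_(j <- s) f j in
    complex.Re S = \sum_(j <- s) complex.Re (f j) /\
    complex.Im S = \sum_(j <- s) complex.Im (f j).
  elim: s => [|j s [IH1 IH2]]; first by rewrite !big_nil.
  by rewrite /= !big_cons -IH1 -IH2; case: (f j) (\sum_(_ <- _) _) => [? ?] [? ?].
have nE (w : C) : complex.Re (n%:R^-1 * w) = n%:R^-1 * complex.Re w /\
    complex.Im (n%:R^-1 * w) = n%:R^-1 * complex.Im w.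
  have -> : n%:R^-1 = (n%:R^-1)%:C%C :> R[i] by rewrite fmorphV rmorph_nat.
  by case: w => x y /=; rewrite !mul0r subr0 addr0.
congr (_ +i* _)%C; apply: (@Rintegral_lyubich a n) => //.
- by move=> x; apply: (@continuous_comp S2 C R phi); [exact: cphi|exact: Re_continuous].
- move=> z z0; rewrite lyubich_monomial//.
  by rewrite (nE _).1 (sumE _ _).1.
- by move=> x; apply: (@continuous_comp S2 C R phi); [exact: cphi|exact: Im_continuous].
- move=> z z0; rewrite lyubich_monomial//.
  by rewrite (nE _).2 (sumE _ _).2.
Qed.

End LyubichCircle.

(** * Upper bounds for the entropy of a coded map *)

Section Gibbs.
Variables (R : realType) (W V : finType) (p q : W -> V -> R).
Hypothesis p_ge0 : forall w v, 0 <= p w v.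
Hypothesis p_sum : \sum_w \sum_v p w v = 1.
Hypothesis q_ge0 : forall w v, 0 <= q w v.
Hypothesis q_sum : \sum_w \sum_v q w v <= 1.
Hypothesis pq : forall w v, 0 < p w v -> 0 < q w v.

(** With s the marginal of p, ln x <= x - 1 at x = q / s gives p (ln s - ln q) >= p - p q / s >= p -
    q, using p <= s. The sum of p - q is nonnegative. *)
Lemma gibbs_marginal :
  \sum_w - ((\sum_v p w v) * ln (\sum_v p w v)) <=
  \sum_w \sum_v p w v * - ln (q w v).
Proof.
pose s w := \sum_v p w v.
have s_ge0 w : 0 <= s w by exact: sumr_ge0.
have le_s w v : p w v <= s w.
  by rewrite /s (bigD1 v)//= lerDl; exact: sumr_ge0.
rewrite -subr_ge0 -sumrB.
apply: (@le_trans _ _ (\sum_w \sum_v (p w v - q w v))).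
  under eq_bigr do rewrite sumrB.
  by rewrite sumrB p_sum subr_ge0.
apply: ler_sum => w _; rewrite opprK mulr_suml -big_split/=.
apply: ler_sum => v _.
have [p0|pn0] := eqVneq (p w v) 0; first by rewrite p0 !mul0r addr0 sub0r oppr_le0.
have p_gt0 : 0 < p w v by rewrite lt_neqAle eq_sym pn0 p_ge0.
have s_gt0 : 0 < s w := lt_le_trans p_gt0 (le_s w v).
have q_gt0 := pq p_gt0.
rewrite -[\sum_v p w v]/(s w).
have : ln (q w v / s w) <= q w v / s w - 1.
  have := @ln_sublinear R (q w v / s w).
  by have := expR_ge1Dx (ln (q w v / s w)); rewrite lnK ?posrE ?divr_gt0//; lra.
rewrite ln_div ?posrE// => h.
have h2 : p w v * (ln (q w v) - ln (s w)) <= p w v * (q w v / s w - 1) by rewrite ler_wpM2l.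
have h3 : p w v * (q w v / s w) <= q w v.
  rewrite mulrCA ger_pMr// ler_pdivrMr// mul1r//.
by lra.
Qed.

End Gibbs.

Section FiniteFibres.
Context {d : measure_display} {T : measurableType d} {R : realType}.
Variables (mu : probability T R) (V : finType) (h : T -> V).
Hypothesis mh : forall v, measurable (h @^-1` [set v]).

Lemma measurable_finite_fibres (A : set V) : measurable (h @^-1` A).
Proof.
have -> : h @^-1` A = \bigcup_(v in A) h @^-1` [set v].
  by apply/seteqP; split=> [x Ax|x [v Av] /= ->//]; exists (h x).
by apply: fin_bigcup_measurable => //; exact: finite_finset.
Qed.

Lemma fin_num_prob A : measurable A -> mu A \is a fin_num.
Proof. by move=> mA; exact: fin_num_measure. Qed.

Lemma sum_fibres (A : pred V) :
  \sum_(v | A v) fine (mu (h @^-1` [set v])) = fine (mu (h @^-1` [set v | A v])).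
Proof.
have H (s : seq V) : uniq s -> \sum_(v <- s) fine (mu (h @^-1` [set v])) =
    fine (mu (h @^-1` [set` s])).
  elim: s => [_|v s IH /= /andP[vs us]].
    by rewrite big_nil (_ : _ @^-1` _ = set0) ?measure0//; apply/seteqP; split.
  rewrite big_cons IH// -fineD ?fin_num_prob//; last exact: measurable_finite_fibres.
  rewrite -measureU//; last 2 first.
  - exact: measurable_finite_fibres.
  - apply/seteqP; split=> // x /= [xv]; rewrite xv => h1; by rewrite h1 in vs.
  congr (fine (mu _)); apply/seteqP; split=> x /=; rewrite inE.
    by case=> [->|->]; rewrite ?eqxx ?orbT.
  by case/orP => [/eqP|]; [left|right].
rewrite -big_filter H ?filter_uniq ?index_enum_uniq//.
by congr (fine (mu _)); apply/seteqP; split=> x /=; rewrite mem_filter mem_index_enum andbT.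
Qed.

End FiniteFibres.

(** * Join entropy of a partition predicted by codes *)

Section CodedEntropy.
Context {d : measure_display} {T : measurableType d} {R : realType}.
Variables (mu : probability T R) (f : T -> T).
Hypothesis mf : measurable_fun setT f.
Hypothesis inv_f : invariant mu f.

Lemma measurable_iter_preimage j A : measurable A -> measurable (iter j f @^-1` A).
Proof.
elim: j A => [//|j IH] A mA.
have -> : iter j.+1 f @^-1` A = iter j f @^-1` (f @^-1` A) by [].
by apply: IH; rewrite -[X in measurable X]setTI; exact: mf.
Qed.

Lemma invariant_iter j A : measurable A -> mu (iter j f @^-1` A) = mu A.
Proof.
elim: j A => [//|j IH] A mA.
have -> : iter j.+1 f @^-1` A = iter j f @^-1` (f @^-1` A) by [].
by rewrite IH ?inv_f// -[X in measurable X]setTI; exact: mf.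
Qed.

Definition codeword (V : Type) (code : T -> V) n (x : T) : {ffun 'I_n -> V} :=
  [ffun j : 'I_n => code (iter j f x)].

Lemma measurable_codeword (V : finType) (code : T -> V) n :
  (forall v, measurable (code @^-1` [set v])) ->
  forall w, measurable (codeword code n @^-1` [set w]).
Proof.
move=> mc w; have -> : codeword code n @^-1` [set w] =
    \bigcap_(j in [set: 'I_n]) (iter j f @^-1` (code @^-1` [set w j])).
  apply/seteqP; split=> [x <- j _|x H]; first by rewrite /= ffunE.
  by apply/ffunP => j; rewrite ffunE; exact: H.
by apply: fin_bigcap_measurable => [|j _]; [exact: finite_finset|exact: measurable_iter_preimage].
Qed.

Variables (D : finType) (code : T -> D) (k : nat) (xi : T -> 'I_k).
Hypothesis mcode : forall v, measurable (code @^-1` [set v]).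
Hypothesis mxi : forall i, measurable (xi @^-1` [set i]).

Variables (K : nat) (g : {ffun 'I_K -> D} -> 'I_k) (e : R).
Hypotheses (e0 : 0 < e) (e1 : e < 1).
Let bad : set T := [set x | xi x <> g (codeword code K x)].
Hypothesis bad_le : fine (mu bad) <= e.

Variables (n : nat) (Q : {ffun 'I_(n + K) -> D} -> R) (H : R).
Hypothesis Q_ge0 : forall c, 0 <= Q c.
Hypothesis Q_sum : \sum_c Q c <= 1.
Hypothesis Q_gt0 : forall x, 0 < Q (codeword code _ x).
Hypothesis Q_ln : forall x, - ln (Q (codeword code _ x)) <= H.

Lemma window_subproof (j : 'I_n) (i : 'I_K) : (j + i < n + K)%N.
Proof. by rewrite -addnS leq_add// ltnW. Qed.

(** The symbol at time j < n is predicted from the codes at times j, ..., j + K - 1, which is why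
    codewords of length n + K are used. *)
Definition window (c : {ffun 'I_(n + K) -> D}) (j : 'I_n) : {ffun 'I_K -> D} :=
  [ffun i : 'I_K => c (Ordinal (window_subproof j i))].

Lemma window_codeword x j :
  window (codeword code _ x) j = codeword code K (iter j f x).
Proof. by apply/ffunP => i; rewrite !ffunE/= addnC iterD. Qed.

Let k0 : (0 < k)%N.
Proof. by case: k (xi point) => [[]|]. Qed.

Let kR : 0 < k%:R :> R. Proof. by rewrite ltr0n. Qed.

(* The conditional probability of the symbol i given a code window c whose
   predicted symbol is g c; the mass e is spread evenly to keep it positive. *)
Let cond (i : 'I_k) c : R := if i == g c then 1 - e else e / k%:R.

Let cond_gt0 i c : 0 < cond i c.
Proof. by rewrite /cond; case: ifP => _; [rewrite subr_gt0|rewrite divr_gt0]. Qed.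

Let cond_sum c : \sum_i cond i c <= 1.
Proof.
rewrite (bigD1 (g c))//= {1}/cond eqxx.
apply: (@le_trans _ _ (1 - e + \sum_(i < k) e / k%:R)).
  rewrite lerD2l [leRHS](bigD1 (g c))//=.
  apply: ler_wpDl; first by rewrite divr_ge0 ?ltW.
  by apply: ler_sum => i ig; rewrite /cond (negbTE ig).
by rewrite sumr_const card_ord -[X in _ + X]mulr_natr divfK ?gt_eqF// subrK.
Qed.

Let word x : {ffun 'I_n -> 'I_k} * {ffun 'I_(n + K) -> D} :=
  (codeword xi n x, codeword code (n + K) x).

Let mword v : measurable (word @^-1` [set v]).
Proof.
have -> : word @^-1` [set v] = (codeword xi n @^-1` [set v.1]) `&`
    (codeword code (n + K) @^-1` [set v.2]).
  apply/seteqP; split=> [x <-//|x [/= h1 h2]].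
  by rewrite /word h1 h2 -surjective_pairing.
by apply: measurableI; exact: measurable_codeword.
Qed.

Let P w c : R := fine (mu (word @^-1` [set (w, c)])).

Let P_ge0 w c : 0 <= P w c. Proof. exact: fine_ge0. Qed.

Let P_gt0 w c : 0 < P w c -> exists x, word x = (w, c).
Proof.
move=> p0; apply: contrapT => nx; move: p0.
rewrite /P (_ : _ @^-1` _ = set0) ?measure0 ?ltxx//.
by apply/seteqP; split=> // x wx; apply: nx; exists x.
Qed.

Let P_pair (A : pred _) :
  \sum_w \sum_(c | A (w, c)) P w c = fine (mu (word @^-1` [set v | A v])).
Proof.
rewrite pair_big_dep/= -(sum_fibres mu mword).
by apply: eq_big => -[w c].
Qed.

Let bigP : \sum_w \sum_c P w c = 1.
Proof.
rewrite (P_pair xpredT) (_ : _ @^-1` _ = setT) ?probability_setT//.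
by apply/seteqP; split.
Qed.

Let P_marginal w : \sum_c P w c = fine (mu [set x | forall j : 'I_n, xi (iter j f x) = w j]).
Proof.
transitivity (\sum_(v | v.1 == w) fine (mu (word @^-1` [set v]))).
  transitivity (\sum_(w' | w' == w) \sum_c P w' c); first by rewrite big_pred1_eq.
  rewrite pair_big_dep/=.
  by apply: eq_big => -[w' c]//=; rewrite andbT.
rewrite (sum_fibres mu mword); congr (fine (mu _)); apply/seteqP; split=> x /=.
  by move=> /eqP <- j; rewrite ffunE.
by move=> xw; apply/eqP/ffunP => j; rewrite ffunE.
Qed.

Let mbad : measurable bad.
Proof.
have -> : bad = ~` (\bigcup_(i in [set: 'I_k])
    (xi @^-1` [set i] `&` codeword code K @^-1` [set c | g c = i])).
  apply/seteqP; split=> [x /= xb [i _ [/= xi_i]]|x /= xb xg].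
    by rewrite -xi_i => gx; apply: xb; rewrite -gx.
  by apply: xb; exists (xi x).
apply: measurableC; apply: fin_bigcup_measurable => [|i _]; first exact: finite_finset.
apply: measurableI => //; apply: measurable_finite_fibres.
exact: measurable_codeword.
Qed.

(** Gibbs' inequality is applied to the joint law P of symbols and codes, against Q on the codes
    times the conditional weights [cond] on the symbols. Each symbol costs -ln (1 - e), plus at most
    -ln (e / k) when its prediction is wrong, an event of probability at most e. *)
Lemma join_entropy_bound :
  join_entropy mu f xi n <= H + n%:R * (- ln (1 - e) + e * - ln (e / k%:R)).
Proof.
pose q (w : {ffun 'I_n -> 'I_k}) c := Q c * \prod_j cond (w j) (window c j).
have q_ge0 w c : 0 <= q w c.
  by rewrite mulr_ge0// prodr_ge0// => j _; exact: ltW.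
have q_sum : \sum_w \sum_c q w c <= 1.
  rewrite exchange_big/=; apply: le_trans Q_sum; apply: ler_sum => c _.
  rewrite -mulr_sumr -(bigA_distr_bigA (fun j i => cond i (window c j))).
  rewrite ler_piMr// prodr_ile1// => j _.
  by rewrite cond_sum andbT sumr_ge0// => i _; exact: ltW.
have pq w c : 0 < P w c -> 0 < q w c.
  by move=> /P_gt0[x [_ <-]]; rewrite mulr_gt0// prodr_gt0.
pose al := - ln (1 - e); pose be := - ln (e / k%:R).
have al0 : 0 <= al by rewrite oppr_ge0 ln_le0// gerBl ltW.
have be0 : 0 <= be.
  by rewrite oppr_ge0 ln_le0// ler_pdivrMr// mul1r (le_trans (ltW e1))// ler1n.
pose b (w : {ffun 'I_n -> 'I_k}) c j : R := (w j != g (window c j))%:R.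
have ln_prod (s : seq 'I_n) (F : 'I_n -> R) : (forall j, 0 < F j) ->
    ln (\prod_(j <- s) F j) = \sum_(j <- s) ln (F j).
  move=> F0; elim: s => [|j s IH]; first by rewrite !big_nil ln1.
  by rewrite !big_cons lnM ?IH// posrE// prodr_gt0.
rewrite /join_entropy; under eq_bigr do rewrite -P_marginal.
apply: le_trans (gibbs_marginal P_ge0 bigP q_ge0 q_sum pq) _.
apply: (@le_trans _ _ (\sum_w \sum_c
    (P w c * (H + n%:R * al) + be * \sum_j P w c * b w c j))).
  apply: ler_sum => w _; apply: ler_sum => c _.
  have [p0|pn0] := eqVneq (P w c) 0.
    by rewrite p0 !mul0r add0r mulr_ge0// sumr_ge0// => j _; rewrite mul0r.
  have p_gt0 : 0 < P w c by rewrite lt_neqAle eq_sym pn0 P_ge0.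
  have [x [_ xc]] := P_gt0 p_gt0.
  have Qc : 0 < Q c by rewrite -xc.
  rewrite -mulr_sumr mulrCA -mulrDr ler_wpM2l// /q lnM ?posrE// ?prodr_gt0//.
  rewrite opprD -addrA lerD//; first by rewrite -xc.
  rewrite ln_prod// -sumrN.
  apply: (@le_trans _ _ (\sum_(j < n) (al + be * b w c j))).
    apply: ler_sum => j _; rewrite /cond /b; case: eqP => _ /=.
      by rewrite mulr0 addr0.
    by rewrite mulr1 lerDr.
  by rewrite big_split/= sumr_const card_ord mulr_natl mulr_sumr.
under eq_bigr do rewrite big_split/= -mulr_suml -mulr_sumr.
rewrite big_split/= -mulr_suml bigP mul1r -mulr_sumr.
rewrite mulrDr addrA lerD2l [leRHS]mulrA [leRHS]mulrC ler_wpM2l//.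
under eq_bigr do rewrite exchange_big/=.
rewrite exchange_big/= mulr_natl -[n in leRHS]card_ord -sumr_const.
apply: ler_sum => j _.
rewrite (_ : \sum_w _ = fine (mu bad))//.
pose A (v : {ffun 'I_n -> 'I_k} * {ffun 'I_(n + K) -> D}) := v.1 j != g (window v.2 j).
transitivity (\sum_w \sum_(c | A (w, c)) P w c).
  apply: eq_bigr => w _; rewrite [RHS]big_mkcond/=; apply: eq_bigr => c _.
  by rewrite /b /A/=; case: (_ != _); rewrite ?mulr1 ?mulr0.
(* A wrong prediction at time j is the preimage of [bad] under the j-th iterate, so by invariance it
   has the measure of [bad]. *)
rewrite P_pair -(invariant_iter j mbad); congr (fine (mu _)).
apply/seteqP; split=> x /=; rewrite /A/= window_codeword ffunE.
  by move=> /eqP.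
by move=> /eqP.
Qed.

End CodedEntropy.

(** * An entropy bound from weights on codes *)

Section EntropyBound.
Context {d : measure_display} {T : measurableType d} {R : realType}.
Variables (mu : probability T R) (f : T -> T).
Hypothesis mf : measurable_fun setT f.
Hypothesis inv_f : invariant mu f.
Variables (D : finType) (code : T -> D) (h b : R).
Hypothesis mcode : forall v, measurable (code @^-1` [set v]).
Hypothesis h_ge0 : 0 <= h.

Hypothesis weights : forall N, exists Q : {ffun 'I_N -> D} -> R,
  [/\ forall c, 0 <= Q c, \sum_c Q c <= 1,
      forall x, 0 < Q (codeword f code N x)
    & forall x, - ln (Q (codeword f code N x)) <= N%:R * h + b].

Hypothesis predict : forall k (xi : T -> 'I_k),
  (forall i, measurable (xi @^-1` [set i])) -> forall e : R, 0 < e ->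
  exists K (ga : T -> 'I_k),
    (forall x y, codeword f code K x = codeword f code K y -> ga x = ga y) /\
    fine (mu [set x | xi x <> ga x]) <= e.

(** The cost per symbol in the bound on the join entropy tends to 0 with the probability of
    error. *)
Lemma small_symbol_cost (k : nat) (e : R) : (0 < k)%N -> 0 < e ->
  exists2 s : R, 0 < s < 1 & - ln (1 - s) + s * - ln (s / k%:R) <= e.
Proof.
move=> k0 e0; have kR : 0 < k%:R :> R by rewrite ltr0n.
have ln_le (x : R) : 0 < x -> ln x <= x - 1.
  by move=> x0; have := expR_ge1Dx (ln x); rewrite lnK//; lra.
(* The witness is s ^ 2: as ln (1 / s) <= 1 / s - 1, the term s ^ 2 ln (k / s ^ 2) is at most s ^ 2
   k + 2 s, and in total the cost is at most s (k + 4) <= e. *)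
pose s := Num.min 2^-1 (e / (k%:R + 4)).
have s0 : 0 < s by rewrite lt_min invr_gt0 ltr0n/= divr_gt0// addr_gt0.
have sh : s <= 2^-1 by rewrite ge_min lexx.
have se : s * (k%:R + 4) <= e.
  by rewrite -ler_pdivlMr ?addr_gt0// ge_min lexx orbT.
have ss0 : 0 < s * s by rewrite mulr_gt0.
have ss1 : s * s <= 2^-1 * s by rewrite ler_pM2r.
exists (s * s); first by apply/andP; split=> //; lra.
have h1 : - ln (1 - s * s) <= 2 * (s * s).
  rewrite -lnV ?posrE; last by lra.
  apply: le_trans (ln_le _ _) _; first by rewrite invr_gt0; lra.
  rewrite lerBlDr -div1r ler_pdivrMr; last by lra.
  nra.
have h2 : - ln (s * s / k%:R) <= k%:R + 2 / s.
  rewrite -lnV ?posrE ?divr_gt0// invf_div lnM ?posrE ?invr_gt0//.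
  rewrite invfM lnM ?posrE ?invr_gt0//.
  have l1 := ln_le _ kR; have := ln_le (s^-1); rewrite invr_gt0 => /(_ s0) l2.
  lra.
have h3 : s * s * - ln (s * s / k%:R) <= s * s * k%:R + 2 * s.
  apply: le_trans (ler_wpM2l (ltW ss0) h2) _.
  by rewrite mulrDr lerD2l mulrCA -mulrA divff ?gt_eqF// mulr1.
have h4 : s * s * k%:R <= s * k%:R by rewrite ler_pM2r// -[leRHS]mulr1 ler_pM2l//; lra.
lra.
Qed.

Lemma entropy_le : (entropy mu f <= h%:E)%E.
Proof.
apply: ge_ereal_sup => _ [k [xi [mxi ->]]].
have k0 : (0 < k)%N by case: (k) (xi point) => [[]|].
(* The limit of a divergent sequence is the default value 0, which is at most h. *)
have [cv|ncv] := pselect (cvgn (fun n => (join_entropy mu f xi n / n%:R)%:E)); last first.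
  by rewrite (dvgP ncv) lee_fin.
apply/lee_addgt0Pr => e e0.
have e2 : 0 < e / 2 by rewrite divr_gt0.
have [s /andP[s0 s1] sE] := small_symbol_cost k0 e2.
have [K [ga [gaP bad]]] := predict mxi s0.
(* One orbit is chosen for each codeword, which turns the prediction [ga] on points into a function
   of codewords. *)
pose rep (w : {ffun 'I_K -> D}) : T := xget point [set x | codeword f code K x = w].
pose g w := ga (rep w).
have gE x : g (codeword f code K x) = ga x.
  apply: gaP; rewrite /rep.
  exact: (@xgetPex _ point [set y | codeword f code K y = codeword f code K x]
    (ex_intro _ x erefl)).
have bad' : fine (mu [set x | xi x <> g (codeword f code K x)]) <= s.
  by under eq_set do rewrite gE.
have je n : join_entropy mu f xi n <= (n + K)%:R * h + b + n%:R * (e / 2).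
  have [Q [Q0 Q1 Qp Ql]] := weights (n + K).
  apply: le_trans (join_entropy_bound mf inv_f mcode mxi s0 s1 bad' Q0 Q1 Qp Ql) _.
  by rewrite lerD2l ler_wpM2l.
apply: lime_le => //; near=> n.
have n0 : 0 < n%:R :> R by rewrite ltr0n; near: n; exists 1%N.
rewrite -EFinD lee_fin ler_pdivrMr//; apply: le_trans (je n) _.
have : K%:R * h + b <= n%:R * (e / 2).
  rewrite -ler_pdivrMr//; near: n; exact: nbhs_infty_ger.
rewrite natrD; nra.
Unshelve. all: by end_near. Qed.

End EntropyBound.

(** * Decreasing sets and recurrence *)

Section SmallSets.
Context {d : measure_display} {T : measurableType d} {R : realType}.
Variable mu : probability T R.

Lemma small_tail (F : nat -> set T) (e : R) : 0 < e ->
  (forall n, measurable (F n)) -> (forall n, F n.+1 `<=` F n) ->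
  mu (\bigcap_n F n) = 0%E -> exists n, (mu (F n) <= e%:E)%E.
Proof.
move=> e0 mF dF F0; apply: contrapT => nF.
have hF n : (e%:E <= mu (F n))%E.
  by rewrite leNgt; apply/negP => h; apply: nF; exists n; exact: ltW.
have cv : (mu \o F) n @[n --> \oo] --> mu (\bigcap_n F n).
  apply: nonincreasing_cvg_mu => //.
  - by rewrite (le_lt_trans (probability_le1 _ _)) ?ltry.
  - exact: bigcap_measurable.
  - by apply/nonincreasing_seqP => n; exact/subsetPset/dF.
have : (e%:E <= mu (\bigcap_n F n))%E.
  rewrite -(cvg_lim _ cv)//; apply: lime_ge; first by apply/cvg_ex; exists (mu (\bigcap_n F n)).
  by apply: nearW => n; exact: hF.
by rewrite F0 lee_fin leNgt e0.
Qed.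

Lemma le_mu (A B : set T) : measurable A -> measurable B -> A `<=` B ->
  (mu A <= mu B)%E.
Proof. by move=> mA mB AB; apply: le_measure; rewrite ?inE. Qed.

(* Poincare recurrence: a point that leaves every F N under iteration would
   have to return. *)
Lemma escape_null (f : T -> T) (F : nat -> set T) :
  measurable_fun setT f -> invariant mu f ->
  (forall n, measurable (F n)) -> (forall n, F n.+1 `<=` F n) ->
  \bigcap_n F n = set0 -> (forall n, F n `<=` f @^-1` F n) ->
  (forall n x, F 0%N x -> exists j, F n (iter j f x)) -> mu (F 0%N) = 0%E.
Proof.
move=> mf inv_f mF dF F0 fF esc; apply/eqP; rewrite eq_le measure_ge0 andbT.
apply/lee_addgt0Pr => e e0; rewrite add0e.
have [|N muN] := small_tail e0 mF dF; first by rewrite F0 measure0.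
apply: le_trans muN.
(* These preimages increase with j, all have measure mu (F N), and together cover F 0; hence mu (F
   0) <= mu (F N). *)
pose G j := iter j f @^-1` F N.
have mG j : measurable (G j) by exact: measurable_iter_preimage.
have cv : (mu \o G) j @[j --> \oo] --> mu (\bigcup_j G j).
  apply: nondecreasing_cvg_mu => //; first exact: bigcup_measurable.
  apply/nondecreasing_seqP => j; apply/subsetPset => x; exact: fF.
have GE : mu \o G = cst (mu (F N)).
  by apply/funext => j; exact: invariant_iter.
have <- : mu (\bigcup_j G j) = mu (F N).
  move: cv; rewrite GE => cv.
  by rewrite -(cvg_lim _ cv)// lim_cst.
apply: le_mu => //; first exact: bigcup_measurable.
by move=> x /(esc N)[j Fj]; exists j.
Qed.

End SmallSets.

(** * Approximation by sets that depend on finitely many codes *)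

Section Approximation.
Context {d : measure_display} {T : measurableType d} {R : realType}.
Variables (mu : probability T R) (f : T -> T) (D : finType) (code : T -> D).
Hypothesis mf : measurable_fun setT f.
Hypothesis mcode : forall v, measurable (code @^-1` [set v]).

Definition cylindric K (E : set T) := forall x y,
  codeword f code K x = codeword f code K y -> E x -> E y.

Lemma codeword_le K K' x y : (K <= K')%N ->
  codeword f code K' x = codeword f code K' y ->
  codeword f code K x = codeword f code K y.
Proof.
move=> KK' /ffunP xy; apply/ffunP => j; rewrite !ffunE.
by have := xy (widen_ord KK' j); rewrite !ffunE.
Qed.

Lemma cylindric_le K K' E : (K <= K')%N -> cylindric K E -> cylindric K' E.
Proof. by move=> KK' cE x y /(codeword_le KK'); exact: cE. Qed.

Lemma measurable_cylindric K E : cylindric K E -> measurable E.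
Proof.
move=> cE; have -> : E = codeword f code K @^-1` (codeword f code K @` E).
  by apply/seteqP; split=> [x Ex|x [y Ey /cE]]; [exists x|exact].
by apply: measurable_finite_fibres; exact: measurable_codeword.
Qed.

Definition symdiff (A E : set T) := (A `\` E) `|` (E `\` A).

Lemma measurable_symdiff A E : measurable A -> measurable E ->
  measurable (symdiff A E).
Proof. by move=> mA mE; apply: measurableU; exact: measurableD. Qed.

Definition approximable (A : set T) : Prop := measurable A /\
  forall e : R, 0 < e -> exists K E, cylindric K E /\ (mu (symdiff A E) <= e%:E)%E.

Lemma approximable_lim A : measurable A ->
  (forall e : R, 0 < e -> exists2 E, approximable E & (mu (symdiff A E) <= e%:E)%E) ->
  approximable A.
Proof.
move=> mA HA; split=> // e e0.
have e2 : 0 < e / 2 by rewrite divr_gt0.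
have [E [mE aE] AE] := HA _ e2; have [K [E' [cE' EE']]] := aE _ e2.
exists K, E'; split=> //; have mE' := measurable_cylindric cE'.
apply: (@le_trans _ _ (mu (symdiff A E) + mu (symdiff E E'))%E); last first.
  by rewrite [e in leRHS]splitr EFinD leeD.
apply: (@le_trans _ _ (mu (symdiff A E `|` symdiff E E'))); last first.
  by apply: measureU2; exact: measurable_symdiff.
apply: le_mu; [exact: measurable_symdiff|by apply: measurableU; exact: measurable_symdiff|].
move=> x; rewrite /symdiff /=; have [] := pselect (E x); tauto.
Qed.

Lemma approximableC A : approximable A -> approximable (~` A).
Proof.
move=> [mA aA]; split=> [|e /aA[K [E [cE AE]]]]; first exact: measurableC.
exists K, (~` E); split=> [x y xy nEx Ey|]; first exact: nEx (cE _ _ (esym xy) Ey).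
rewrite (_ : symdiff _ _ = symdiff A E)//; apply/seteqP; split=> x;
  rewrite /symdiff /=; have [] := pselect (E x); have [] := pselect (A x); tauto.
Qed.

Lemma approximableU A A' : approximable A -> approximable A' -> approximable (A `|` A').
Proof.
move=> [mA aA] [mA' aA']; split=> [|e e0]; first exact: measurableU.
have e2 : 0 < e / 2 by rewrite divr_gt0.
have [K [E [cE AE]]] := aA _ e2; have [K' [E' [cE' AE']]] := aA' _ e2.
have mE := measurable_cylindric cE; have mE' := measurable_cylindric cE'.
exists (maxn K K'), (E `|` E'); split.
  move=> x y xy [Ex|Ex]; [left; apply: cE Ex|right; apply: cE' Ex].
    exact: codeword_le (leq_maxl _ _) xy.
  exact: codeword_le (leq_maxr _ _) xy.
apply: (@le_trans _ _ (mu (symdiff A E) + mu (symdiff A' E'))%E); last first.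
  by rewrite [e in leRHS]splitr EFinD leeD.
apply: (@le_trans _ _ (mu (symdiff A E `|` symdiff A' E'))); last first.
  by apply: measureU2; exact: measurable_symdiff.
apply: le_mu; [|by apply: measurableU; exact: measurable_symdiff|].
  by apply: measurable_symdiff; exact: measurableU.
move=> x; rewrite /symdiff /=; have [] := pselect (E x); have [] := pselect (A x); tauto.
Qed.

Lemma approximable0 : approximable set0.
Proof.
split=> // e e0; exists 0%N, set0; split=> //.
by rewrite /symdiff !setD0 setU0 measure0 lee_fin ltW.
Qed.

(** Finite unions are approximable, and what they miss of the whole union decreases to the empty
    set. *)
Lemma approximable_bigcup (A : nat -> set T) : (forall n, approximable (A n)) ->
  approximable (\bigcup_n A n).
Proof.
move=> aA; have mA n : measurable (A n) by case: (aA n).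
apply: approximable_lim => [|e e0]; first exact: bigcup_measurable.
pose B N := \bigcup_(n in `I_N) A n.
have BS N : B N.+1 = B N `|` A N.
  apply/seteqP; split=> [x [n /= nN Anx]|x [[n /= nN Anx]|ANx]].
  - move: nN; rewrite ltnS leq_eqVlt => /predU1P[<-|nN]; [by right|by left; exists n].
  - by exists n => //=; rewrite ltnS ltnW.
  - by exists N => /=.
have aB N : approximable (B N).
  elim: N => [|N IH]; last by rewrite BS; exact: approximableU.
  by rewrite (_ : B 0%N = set0); [exact: approximable0|apply/seteqP; split=> // x []].
have mB N : measurable (B N) by case: (aB N).
have mU : measurable (\bigcup_n A n) by exact: bigcup_measurable.
have [|||N muN] := @small_tail _ _ _ mu (fun N => (\bigcup_n A n) `\` B N) e e0.
- by move=> N; exact: measurableD.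
- by move=> N x [Ux nBx]; split=> // Bx; apply: nBx; rewrite BS; left.
- rewrite (_ : \bigcap_n _ = set0) ?measure0//; apply/seteqP; split=> // x Hx.
  have [[n _ Anx] _] := Hx 0%N I.
  by have [_] := Hx n.+1 I; apply; exists n => /=.
exists (B N) => //; rewrite /symdiff (_ : B N `\` _ = set0) ?setU0//.
by apply/seteqP; split=> // x [[n _ Anx]]; apply; exists n.
Qed.

Lemma approximable_sigma (G : set (set T)) : G `<=` approximable ->
  <<s G >> `<=` approximable.
Proof.
move=> GA; apply: smallest_sub => //; split.
- exact: approximable0.
- by move=> A aA; rewrite setTD; exact: approximableC.
- exact: approximable_bigcup.
Qed.

(** Each level set of xi is approximated within e / k by a cylindric set, and some i whose set
    contains x is predicted. Off the k symmetric differences exactly one i qualifies, so the default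
    in [ga] matters only on the exceptional set. *)
Lemma approximable_predict (k : nat) (xi : T -> 'I_k) (e : R) : 0 < e ->
  (forall i, approximable (xi @^-1` [set i])) ->
  exists K (ga : T -> 'I_k),
    (forall x y, codeword f code K x = codeword f code K y -> ga x = ga y) /\
    fine (mu [set x | xi x <> ga x]) <= e.
Proof.
move=> e0 axi; have k0 : (0 < k)%N by case: (k) (xi point) => [[]|].
have ek : 0 < e / k%:R by rewrite divr_gt0 ?ltr0n.
have /choice[KE KEP] : forall i, exists KE : nat * set T, cylindric KE.1 KE.2 /\
    (mu (symdiff (xi @^-1` [set i]) KE.2) <= (e / k%:R)%:E)%E.
  by move=> i; have [K [E HE]] := (axi i).2 _ ek; exists (K, E).
pose K := \max_i (KE i).1.
have cE i : cylindric K (KE i).2.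
  by apply: cylindric_le (KEP i).1; exact: (leq_bigmax i).
pose ga x := odflt (xi point) [pick i | `[< (KE i).2 x >]].
exists K, ga; split.
  move=> x y xy; rewrite /ga; congr odflt; apply: eq_pick => i.
  by apply/asboolP/asboolP; apply: cE.
pose S i := symdiff (xi @^-1` [set i]) (KE i).2.
have mxi i : measurable (xi @^-1` [set i]) := (axi i).1.
have mS i : measurable (S i).
  by apply: measurable_symdiff => //; exact: measurable_cylindric (cE i).
pose U := \big[setU/set0]_(i < k) S i.
have mUs (s : seq 'I_k) : measurable (\big[setU/set0]_(i <- s) S i).
  by elim: s => [|i s IH]; rewrite ?big_nil ?big_cons//; exact: measurableU.
have muU : (mu U <= e%:E)%E.
  have H (s : seq 'I_k) :
      (mu (\big[setU/set0]_(i <- s) S i) <= ((e / k%:R) *+ size s)%:E)%E.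
    elim: s => [|i s IH]; first by rewrite big_nil measure0.
    rewrite big_cons /= mulrS EFinD.
    apply: (@le_trans _ _ (mu (S i) + mu (\big[setU/set0]_(j <- s) S j))%E).
      by apply: measureU2.
    by apply: leeD => //; exact: (KEP i).2.
  apply: le_trans (H _) _.
  by rewrite /index_enum -enumT size_enum_ord lee_fin -[leLHS]mulr_natr divfK// pnatr_eq0 -lt0n.
have sub : [set x | xi x <> ga x] `<=` U.
  move=> x /= xg; apply: contrapT => nU.
  have nS i : ~ S i x by move=> Six; apply: nU; rewrite /U (bigD1 i)//=; left.
  have hE i : (KE i).2 x <-> xi x = i.
    by split=> h; apply: contrapT => nh; apply: (nS i); [right|left].
  apply: xg; rewrite /ga; case: pickP => [i /asboolP/hE//|/(_ (xi x))].
  by move=> /asboolP; case; exact/hE.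
have mbad : measurable [set x | xi x <> ga x].
  rewrite (_ : [set x | _] = \bigcup_(i in [set: 'I_k])
      (xi @^-1` [set i] `&` ~` [set x | ga x = i])).
    apply: fin_bigcup_measurable => [|i _]; first exact: finite_finset.
    apply: measurableI => //; apply: measurableC.
    apply: (@measurable_cylindric K) => x y xy /= <-.
    rewrite /ga; congr odflt; apply: eq_pick => j.
    by apply/asboolP/asboolP; apply: cE.
  apply/seteqP; split=> [x /= xg|x [i _ [/= -> /nesym]]]//.
  by exists (xi x) => //; split=> //= /esym.
rewrite -lee_fin fineK ?fin_num_prob//.
by apply: le_trans muU; apply: le_mu => //; exact: mUs.
Qed.

End Approximation.

(** * The entropy of the squaring map *)

Section Squaring.
Variable R : realType.
Local Notation C := (Cplx R).
Local Notation S2 := (sphere R).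
Local Notation B := (Borel R).

Definition squaring : S2 -> S2 := monomial (1 : C) 2.

Lemma squaring_None : squaring None = None.
Proof. by rewrite /squaring monomial_None ?oner_eq0. Qed.

Lemma squaring_Some (z : C) : squaring (Some z) = Some (z ^+ 2).
Proof. by rewrite /squaring monomial_Some mul1r. Qed.

Lemma measurable_squaring : measurable_fun setT (squaring : B -> B).
Proof. exact: measurable_monomial. Qed.

Lemma Re_sqr (z : C) : complex.Re (z ^+ 2) = complex.Re z ^+ 2 - complex.Im z ^+ 2.
Proof. by rewrite expr2; case: z => a b /=; rewrite !expr2. Qed.

Lemma Im_sqr (z : C) : complex.Im (z ^+ 2) = 2 * (complex.Re z * complex.Im z).
Proof. by rewrite expr2; case: z => a b /=; ring. Qed.

Lemma sqnorm_sqr (z : C) : sqnorm (z ^+ 2) = sqnorm z ^+ 2.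
Proof. by rewrite /sqnorm Re_sqr Im_sqr; ring. Qed.

(** The fixed points infinity and 0 get symbols of their own, with first component false; for the
    other points the second component records the half plane. *)
Definition code (x : S2) : bool * bool :=
  match x with
  | None => (false, false)
  | Some z => if z == 0 then (false, true) else (true, `[< @upper R x >])
  end.

Lemma measurable_code v : measurable (code @^-1` [set v] : set B).
Proof.
have m1 := @measurable_infty R; have m2 := @measurable_point R 0.
have m3 := @measurable_upper R.
have u0 : ~ @upper R (Some 0) by case=> [|[_]] /=; rewrite ltxx.
have E1 : code @^-1` [set (false, false)] = [set None].
  apply/seteqP; split=> [[z|]//=|_ ->//].
  by case: ifP.
have E2 : code @^-1` [set (false, true)] = [set Some 0].
  apply/seteqP; split=> [[z|]//=|_ ->/=]; last by rewrite eqxx.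
  by case: eqP => [->|].
have E3 : code @^-1` [set (true, true)] = @upper R.
  apply/seteqP; split=> [[z|]//=|[z|]//= uz].
    by case: eqP => // _ [/asboolP].
  case: eqP => [z0|_]; first by case: u0; rewrite -z0.
  by congr (_, _); apply/asboolP.
have E4 : code @^-1` [set (true, false)] =
    ~` ([set None] `|` [set Some 0] `|` @upper R).
  rewrite -E1 -E2 -E3; apply/seteqP; split=> [x /= ->|x /= h].
    by move=> [[]|].
  case E : (code x) => [[] []]//; exfalso; apply: h; rewrite E; tauto.
case: v => [[] []]; rewrite ?E1 ?E2 ?E3 ?E4//.
by apply: measurableC; apply: measurableU => //; exact: measurableU.
Qed.

Local Notation cw := (@codeword _ B squaring _ code).

(* The code along an orbit is constant at 0 and at infinity, and otherwise has
   first components true: Q mixes the three corresponding product measures. *)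
Lemma code_weights N : exists Q : {ffun 'I_N -> bool * bool} -> R,
  [/\ forall c, 0 <= Q c, \sum_c Q c <= 1,
      forall x, 0 < Q (cw N x)
    & forall x, - ln (Q (cw N x)) <= N%:R * ln 2 + ln 3].
Proof.
pose q1 (v : bool * bool) : R := if v.1 then 2^-1 else 0.
pose q2 (v : bool * bool) : R := (v == (false, false))%:R.
pose q3 (v : bool * bool) : R := (v == (false, true))%:R.
have sum4 (q : bool * bool -> R) : \sum_v q v =
    q (true, true) + q (true, false) + (q (false, true) + q (false, false)).
  rewrite (eq_bigr (fun v => q (v.1, v.2))) => [|[]]//.
  rewrite -(pair_bigA _ (fun a b => q (a, b)))/=.
  by rewrite !big_bool/=.
have prod_sum (q : bool * bool -> R) : \sum_v q v = 1 ->
    \sum_(c : {ffun 'I_N -> bool * bool}) \prod_i q (c i) = 1.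
  move=> q1E; rewrite -(bigA_distr_bigA (fun _ => q)).
  by rewrite big1.
pose Q (c : {ffun 'I_N -> bool * bool}) : R :=
  3^-1 * (\prod_i q1 (c i) + \prod_i q2 (c i) + \prod_i q3 (c i)).
have q1_ge0 v : 0 <= q1 v by rewrite /q1; case: ifP; rewrite ?invr_ge0.
have q2_ge0 v : 0 <= q2 v by rewrite ler0n.
have q3_ge0 v : 0 <= q3 v by rewrite ler0n.
have P1 (c : {ffun 'I_N -> bool * bool}) : 0 <= \prod_i q1 (c i) by exact: prodr_ge0.
have P2 (c : {ffun 'I_N -> bool * bool}) : 0 <= \prod_i q2 (c i) by exact: prodr_ge0.
have P3 (c : {ffun 'I_N -> bool * bool}) : 0 <= \prod_i q3 (c i) by exact: prodr_ge0.
have h1 : (2^-1 : R) ^+ N <= 1 by rewrite exprn_ile1// ?invr_ge0// invf_le1// ler1n.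
(* On every codeword that occurs, one of the three products is at least 2 ^ -N; the mixing factor
   1/3 accounts for the ln 3. *)
have lower x : 3^-1 * 2^-1 ^+ N <= Q (cw N x).
  rewrite /Q ler_pM2l ?invr_gt0//.
  case: x => [z|].
    have [->|z0] := eqVneq z 0.
      have -> : \prod_i q3 (cw N (Some 0) i) = 1.
        apply: big1 => i _; rewrite ffunE (_ : iter i squaring _ = Some 0) /=.
          by rewrite eqxx.
        elim: (val i) => // j IH; by rewrite iterS IH squaring_Some expr0n.
      by rewrite (le_trans h1)// lerDr addr_ge0.
    have -> : \prod_i q1 (cw N (Some z) i) = 2^-1 ^+ N.
      transitivity (\prod_(i < N) (2^-1 : R)); last by rewrite prodr_const card_ord.
      apply: eq_bigr => i _; rewrite ffunE.
      have [w w0 ->] : exists2 w : C, w != 0 & iter i squaring (Some z) = Some w.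
        elim: (val i) => [|j [w w0 IH]]; first by exists z.
        by exists (w ^+ 2); [rewrite expf_neq0|rewrite iterS IH squaring_Some].
      by rewrite /= (negbTE w0).
    by rewrite -addrA lerDl addr_ge0.
  have -> : \prod_i q2 (cw N None i) = 1.
    apply: big1 => i _; rewrite ffunE (_ : iter i squaring _ = None) //.
    elim: (val i) => // j IH; by rewrite iterS IH squaring_None.
  by rewrite (le_trans h1)// addrAC lerDr addr_ge0.
have low_gt0 : 0 < 3^-1 * 2^-1 ^+ N :> R by rewrite mulr_gt0 ?invr_gt0// exprn_gt0 ?invr_gt0.
exists Q; split.
- by move=> c; rewrite mulr_ge0 ?invr_ge0// !addr_ge0.
- rewrite -mulr_sumr !big_split/= !prod_sum.
  + by lra.
  + by rewrite sum4 /q3/=; lra.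
  + by rewrite sum4 /q2/=; lra.
  + by rewrite sum4 /q1/=; lra.
- by move=> x; apply: lt_le_trans low_gt0 (lower x).
- move=> x; rewrite lerNl; apply: (@le_trans _ _ (ln (3^-1 * 2^-1 ^+ N))).
    rewrite lnM ?posrE ?invr_gt0 ?exprn_gt0 ?invr_gt0// lnV ?posrE//.
    by rewrite lnXn ?invr_gt0// lnV ?posrE// -mulr_natl; lra.
  by rewrite ler_ln ?posrE// (lt_le_trans low_gt0).
Qed.

End Squaring.

(** * Points of the circle are determined by their codes *)

Section SquaringEntropy.
Variable R : realType.
Local Notation C := (Cplx R).
Local Notation S2 := (sphere R).
Local Notation B := (Borel R).
Local Notation f := (@squaring R : B -> B).
Local Notation cw := (@codeword _ B f _ (@code R)).

(** As Im (z ^ 2) = 2 Re z Im z, the half planes of z and z ^ 2 give the sign of Im z and then that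
    of Re z. Weak inequalities absorb the boundary cases. *)
Lemma quadrant (z : C) :
  [/\ upper (Some z) -> upper (Some (z ^+ 2)) -> 0 <= complex.Re z /\ 0 <= complex.Im z,
      upper (Some z) -> ~ upper (Some (z ^+ 2)) -> complex.Re z <= 0 /\ 0 <= complex.Im z,
      ~ upper (Some z) -> upper (Some (z ^+ 2)) -> complex.Re z <= 0 /\ complex.Im z <= 0
    & ~ upper (Some z) -> ~ upper (Some (z ^+ 2)) -> 0 <= complex.Re z /\ complex.Im z <= 0].
Proof.
have UE w : @upper R (Some w) =
    (0 < complex.Im w \/ complex.Im w = 0 /\ 0 < complex.Re w) by [].
rewrite !UE Re_sqr Im_sqr; set a := complex.Re z; set b := complex.Im z.
have notU (x y : R) : ~ (0 < y \/ y = 0 /\ 0 < x) -> y < 0 \/ y = 0 /\ x <= 0.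
  move=> h; have [y0|y0|y0] := ltgtP y 0; [by left|by case: h; left|right; split=> //].
  by rewrite leNgt; apply/negP => x0; apply: h; right.
split.
- move=> [b0|[b0 a0]] h; last by rewrite b0 lexx ltW.
  split; last exact: ltW.
  by case: h => [ab|[ab ab2]]; [nra|have : a = 0 by nra]; move=> ->.
- move=> [b0|[b0 a0]] /notU h.
    by split; [case: h => [ab|[ab ab2]]; nra|exact: ltW].
  by case: h => [ab|[ab ab2]]; nra.
- move=> /notU[b0|[b0 a0]] h; last by rewrite b0 lexx.
  by split; [case: h => [ab|[ab ab2]]; nra|exact: ltW].
- move=> /notU[b0|[b0 a0]] /notU h.
    by split; [case: h => [ab|[ab ab2]]; nra|exact: ltW].
  rewrite b0 lexx; split=> //.
  by case: h => [ab|[ab ab2]]; nra.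
Qed.

Lemma code_asbool (x w : C) : x != 0 -> w != 0 -> code (Some x) = code (Some w) ->
  (@upper R (Some x) <-> @upper R (Some w)).
Proof.
move=> x0 w0; rewrite /code (negbTE x0) (negbTE w0) => -[h].
by split=> [/asboolP|/asboolP]; [rewrite h|rewrite -h] => /asboolP.
Qed.

(* The codes of a point of the circle and of its square determine its quadrant,
   and two points x, w of a common quadrant satisfy |x + w| ^ 2 >= 2. *)
Lemma squaring_expands (x w : C) : sqnorm x = 1 -> sqnorm w = 1 ->
  code (Some x) = code (Some w) -> code (Some (x ^+ 2)) = code (Some (w ^+ 2)) ->
  2 * sqnorm (x - w) <= sqnorm (x ^+ 2 - w ^+ 2).
Proof.
move=> x1 w1.
have nz (z : C) : sqnorm z = 1 -> z != 0.
  by apply: contra_eq_neq => ->; rewrite sqnorm0 eq_sym oner_eq0.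
have x0 := nz _ x1; have w0 := nz _ w1.
move=> /(code_asbool x0 w0) h1 /(code_asbool (expf_neq0 2 x0) (expf_neq0 2 w0)) h2.
have ip : 0 <= complex.Re x * complex.Re w + complex.Im x * complex.Im w.
  have [q1 q2 q3 q4] := quadrant x; have [p1 p2 p3 p4] := quadrant w.
  have [u1|u1] := pselect (@upper R (Some x)); have [u2|u2] := pselect (@upper R (Some (x ^+ 2))).
  - have [a b] := q1 u1 u2; have [c d] := p1 (h1.1 u1) (h2.1 u2).
    by apply: addr_ge0; apply: mulr_ge0.
  - have [a b] := q2 u1 u2; have [c d] := p2 (h1.1 u1) (fun u => u2 (h2.2 u)).
    by apply: addr_ge0; [apply: mulr_le0|apply: mulr_ge0].
  - have [a b] := q3 u1 u2; have [c d] := p3 (fun u => u1 (h1.2 u)) (h2.1 u2).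
    by apply: addr_ge0; apply: mulr_le0.
  - have [a b] := q4 u1 u2; have [c d] := p4 (fun u => u1 (h1.2 u)) (fun u => u2 (h2.2 u)).
    by apply: addr_ge0; [apply: mulr_ge0|apply: mulr_le0].
have -> : sqnorm (x ^+ 2 - w ^+ 2) = sqnorm (x - w) * sqnorm (x + w).
  rewrite subr_sqr; move: (x - w) (x + w) => [a b] [c d].
  by rewrite /sqnorm/=; ring.
rewrite mulrC ler_wpM2l ?sqnorm_ge0//.
have -> : sqnorm (x + w) = sqnorm x + sqnorm w +
    2 * (complex.Re x * complex.Re w + complex.Im x * complex.Im w).
  by case: (x) (w) => [a b] [c d]; rewrite /sqnorm/=; ring.
rewrite x1 w1; lra.
Qed.

(** Squaring at least doubles |x - w| ^ 2 while two successive codes agree, and on the circle this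
    quantity is at most 4. A word of K + 1 codes contains K such pairs. *)
Lemma codeword_contracts K (x w : C) : sqnorm x = 1 -> sqnorm w = 1 ->
  cw K.+1 (Some x) = cw K.+1 (Some w) -> sqnorm (x - w) * 2 ^+ K <= 4.
Proof.
elim: K x w => [|K IH] x w x1 w1 /ffunP xw.
  rewrite expr0 mulr1; case: x w x1 w1 {xw} => [a b] [c d]; rewrite /sqnorm/= => h1 h2.
  have := sqr_ge0 (a + c); have := sqr_ge0 (b + d); nra.
have c0 : code (Some x) = code (Some w) by have := xw ord0; rewrite !ffunE.
have sh (z : C) (j : 'I_K.+1) :
    cw K.+2 (Some z) (lift ord0 j) = cw K.+1 (Some (z ^+ 2)) j.
  by rewrite !ffunE lift0 -squaring_Some -iterSr.
have c12 : cw K.+1 (Some (x ^+ 2)) = cw K.+1 (Some (w ^+ 2)).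
  by apply/ffunP => j; rewrite -!sh xw.
have c1 : code (Some (x ^+ 2)) = code (Some (w ^+ 2)).
  by have := congr1 (fun c : {ffun 'I_K.+1 -> _} => c ord0) c12; rewrite !ffunE.
have n1 (z : C) : sqnorm z = 1 -> sqnorm (z ^+ 2) = 1.
  by move=> z1; rewrite sqnorm_sqr z1 expr1n.
apply: le_trans (IH _ _ (n1 _ x1) (n1 _ w1) c12).
rewrite exprS mulrA [_ * 2]mulrC ler_wpM2r ?exprn_ge0//.
exact: squaring_expands.
Qed.

(** * Invariant measures of the squaring map *)

Section InvariantMeasure.
Variable nu : probability B R.
Hypothesis inv_nu : invariant nu f.

(** The sets {u > N + 1} are forward invariant with empty intersection, and every point with u > 1
    enters each of them, so recurrence applies. Taking u to be |z| ^ 2 or its inverse covers escape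
    to infinity and to 0. *)
Lemma escape_modulus (u : C -> R) : (forall z, u (z ^+ 2) = u z ^+ 2) ->
  (forall N, measurable ([set Some z | z in [set z | N.+1%:R < u z]] : set B)) ->
  nu [set Some z | z in [set z | 1 < u z]] = 0%E.
Proof.
move=> u2 mu; pose F N : set B := [set Some z | z in [set z | N.+1%:R < u z]].
apply: (@escape_null _ _ _ nu f F (@measurable_squaring R)) => //.
- move=> N _ [z /= Nz <-]; exists z => //=; apply: lt_trans Nz.
  by rewrite ltr_nat.
- apply/seteqP; split=> // x Hx.
  have [z _ zx] := Hx 0%N I; have := archi_boundP (normr_ge0 (u z)).
  set N := Num.bound _ => uN; have [w /= Nw wx] := Hx N I.
  have wz : w = z by move: zx; rewrite -wx => -[].
  have NN : N%:R < N.+1%:R :> R by rewrite ltr_nat.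
  have := lt_trans uN NN.
  by rewrite ltNge (ltW (lt_le_trans Nw _))// wz ler_norm.
- move=> N _ [z /= Nz <-]; rewrite /preimage/= squaring_Some.
  exists (z ^+ 2) => //=; rewrite u2 expr2.
  have : 1 <= N.+1%:R :> R by rewrite ler1n.
  by nra.
move=> n _ [z /= z1 <-]; pose e := u z - 1.
have e0 : 0 < e by rewrite subr_gt0.
(* Linear growth suffices: if u >= 1 + e then u ^ 2 >= (1 + e) u >= u + e. *)
have H j : exists w, [/\ iter j f (Some z) = Some w, u z <= u w & 1 + j%:R * e <= u w].
  elim: j => [|j [w [wE zw jw]]]; first by exists z; split=> //; rewrite mul0r addr0 ltW.
  exists (w ^+ 2); rewrite iterS wE squaring_Some u2 -natr1.
  have uzE : u z = 1 + e by rewrite /e addrC subrK.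
  have h1 : 0 <= u w * (u w - u z) by rewrite mulr_ge0 ?subr_ge0//; lra.
  have h2 : 0 <= e * (u w - 1) by rewrite mulr_ge0 ?ltW//; lra.
  by move: h1; rewrite uzE => h1; split=> //; rewrite expr2; lra.
have := archi_boundP (_ : 0 <= n.+1%:R / e); rewrite divr_ge0 ?ltW// => /(_ isT).
set j := Num.bound _ => nj; have [w [wE _ jw]] := H j.
exists j; rewrite wE; exists w => //=; apply: lt_le_trans jw.
by move: nj; rewrite ltr_pdivrMr//; lra.
Qed.

(* By recurrence, an invariant measure lives on the circle, 0 and infinity. *)
Definition core : set B :=
  [set x | if x is Some z then z = 0 \/ sqnorm z = 1 else True].

Lemma measurable_core_nu : measurable core /\ nu (~` core) = 0%E.
Proof.
have mo (p : set C) : open p -> measurable ([set Some z | z in p] : set B).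
  exact: measurable_Some.
have o1 (r : R) : open [set z : C | r < sqnorm z].
  by apply: (@open_comp _ _ (@sqnorm R) [set y | r < y]) => [? _|];
    [exact: sqnorm_continuous|exact: open_gt].
have o2 (r : R) : open [set z : C | sqnorm z < r].
  by apply: (@open_comp _ _ (@sqnorm R) [set y | y < r]) => [? _|];
    [exact: sqnorm_continuous|exact: open_lt].
(* As the inverse of 0 is 0, the point 0 is left out of this set, whence the condition 0 <
   [sqnorm z]. *)
have Vgt N : [set z : C | N.+1%:R < (sqnorm z)^-1] =
    [set z | 0 < sqnorm z] `&` [set z | sqnorm z < N.+1%:R^-1].
  apply/seteqP; split=> z /=.
    move=> h; have s0 : 0 < sqnorm z.
      by rewrite -invr_gt0 (lt_trans _ h)// ltr0n.
    by split=> //; rewrite -[sqnorm z]invrK ltf_pV2// posrE ?ltr0n// invr_gt0.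
  by move=> [s0 h]; rewrite -[N.+1%:R]invrK ltf_pV2// posrE invr_gt0 ltr0n.
have m1 N : measurable ([set Some z | z in [set z | N.+1%:R < sqnorm z]] : set B).
  by apply: mo; exact: o1.
have m2 N : measurable ([set Some z | z in [set z | N.+1%:R < (sqnorm z)^-1]] : set B).
  by apply: mo; rewrite Vgt; apply: openI; [exact: o1|exact: o2].
have m1' : measurable ([set Some z | z in [set z | 1 < sqnorm z]] : set B) := m1 0%N.
have m2' : measurable ([set Some z | z in [set z | 1 < (sqnorm z)^-1]] : set B) := m2 0%N.
have n1 := escape_modulus (@sqnorm_sqr R) m1.
have n2 : nu [set Some z | z in [set z | 1 < (sqnorm z)^-1]] = 0%E.
  by apply: (@escape_modulus (fun z => (sqnorm z)^-1)) => // z; rewrite sqnorm_sqr exprVn.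
have cE : ~` core = [set Some z | z in [set z | 1 < sqnorm z]] `|`
    [set Some z | z in [set z | 1 < (sqnorm z)^-1]].
  apply/seteqP; split=> [[z|]/= h|x].
  - have s0 : 0 < sqnorm z by apply: sqnorm_gt0; apply/eqP => z0; apply: h; left.
    have [z1|z1|z1] := ltgtP (sqnorm z) 1.
    + by right; exists z => //=; rewrite invf_gt1.
    + by left; exists z.
    + by exfalso; apply: h; right.
  - by exfalso; apply: h.
  - move=> [[z /= z1 <-]|[z /= z1 <-]] /= [z0|zn].
    + by move: z1; rewrite z0 sqnorm0 ltr10.
    + by move: z1; rewrite zn ltxx.
    + by move: z1; rewrite z0 sqnorm0 invr0 ltr10.
    + by move: z1; rewrite zn invr1 ltxx.
split; first by rewrite -[core]setCK cE; apply: measurableC; apply: measurableU;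
  [exact: m1'|exact: m2'].
apply/eqP; rewrite eq_le measure_ge0 andbT cE.
apply: le_trans; first by apply: measureU2; [exact: m1'|exact: m2'].
by rewrite [X in (X + _)%E]n1 [X in (_ + X)%E]n2 adde0.
Qed.

(** The set E K consists of the points all of whose core companions with the same K codes lie in O.
    Core points of O are eventually in E K since their cylinders shrink, and E K leaves O only
    outside the core, a null set. *)
Lemma open_approximable (O : set S2) : open O -> @approximable _ B R nu f _ (@code R) O.
Proof.
move=> opO; have [mcore nucore] := measurable_core_nu.
split; first exact: open_measurable_sphere.
move=> e e0; have mO := open_measurable_sphere opO.
pose E K : set B := [set x | forall y, core y -> cw K x = cw K y -> O y].
have cE K : cylindric f (@code R) K (E K).
  by move=> x y xy Ex w cw_ yw; apply: Ex => //; rewrite xy.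
have mE K : measurable (E K).
  exact: measurable_cylindric (@measurable_squaring R) (@measurable_code R) _ _ (cE K).
have [|||K muK] := @small_tail _ _ _ nu (fun K => O `\` E K) e e0.
- by move=> K; exact: measurableD.
- move=> K x [Ox nE]; split=> // Ex; apply: nE => y cy xy; apply: Ex => //.
  exact: codeword_le xy.
- apply/eqP; rewrite eq_le measure_ge0 andbT -nucore; apply: le_mu.
  + by apply: bigcap_measurable => // K _; exact: measurableD.
  + exact: measurableC.
  move=> x Hx cx; have [Ox _] := Hx 0%N I.
  suff [K EK] : exists K, E K x by have [_] := Hx K I.
  (* The points infinity and 0 are the only ones with their first code, so K = 1 works; on the
     circle the contraction is needed. *)
  case: x Ox cx {Hx} => [z|] Ox cx; last first.
    exists 1%N => -[w|] // _ /ffunP/(_ ord0); rewrite !ffunE/=.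
    by case: ifP.
  case: cx => [z0|z1].
    exists 1%N => -[w|] // _ /ffunP/(_ ord0); rewrite !ffunE/= z0 eqxx//.
    by case: eqP => // -> _; rewrite -z0.
  have : nbhs z (Some @^-1` O).
    have : nbhs (Some z : S2) O by apply: open_nbhs_nbhs.
    exact: one_point_compactification_some_continuous.
  move=> /complex_near[r r0 rO].
  have r2 : 0 < r ^+ 2 by rewrite exprn_gt0.
  (* With K > 4 / r ^ 2 and 2 ^ K > K, the contraction bound 4 / 2 ^ K is below r ^ 2. *)
  have := archi_boundP (_ : 0 <= 4 / r ^+ 2); rewrite divr_ge0 ?ltW// => /(_ isT).
  set K := Num.bound _ => rK.
  exists K.+1 => -[w|] cw_ /esym zw; last first.
    by move: zw => /ffunP/(_ ord0); rewrite !ffunE/=; case: ifP.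
  have w1 : sqnorm w = 1.
    case: cw_ => // w0; move: zw => /ffunP/(_ ord0); rewrite !ffunE/= w0 eqxx.
    by case: eqP => // zz; move: z1; rewrite zz sqnorm0 => /esym/eqP; rewrite oner_eq0.
  have ct := codeword_contracts z1 w1 (esym zw).
  have KK : K%:R < 2 ^+ K :> R by rewrite -natrX ltr_nat ltn_expl.
  have small : sqnorm (z - w) < r ^+ 2.
    have p0 : 0 < 2 ^+ K :> R by rewrite exprn_gt0.
    rewrite -(ltr_pM2r p0); apply: le_lt_trans ct _.
    rewrite mulrC -ltr_pdivrMr//; exact: lt_trans rK KK.
  have absr (t : R) : t ^+ 2 < r ^+ 2 -> `|t| < r.
    move=> tr; rewrite ltNge; apply/negP => rt; move: tr; apply/negP.
    rewrite -leNgt -[t ^+ 2]real_normK ?num_real//.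
    by apply: lerXn2r => //; rewrite nnegrE ?ltW// normr_ge0.
  apply: rO; apply: absr; apply: le_lt_trans small; rewrite sqnormB.
    by rewrite lerDl sqr_ge0.
  by rewrite lerDr sqr_ge0.
exists K, (E K); split=> //.
apply: (@le_trans _ _ (nu ((O `\` E K) `|` ~` core))).
  apply: le_mu.
  - exact: measurable_symdiff.
  - by apply: measurableU; [exact: measurableD|exact: measurableC].
  move=> x [[Ox nEx]|[Ex nOx]]; first by left.
  by right => cx; apply: nOx; exact: Ex.
apply: le_trans.
  by apply: measureU2; [exact: measurableD|exact: measurableC].
by rewrite [X in (_ + X)%E]nucore adde0.
Qed.

Lemma squaring_entropy_le : (entropy nu f <= (ln 2)%:E)%E.
Proof.
apply: (@entropy_le _ _ _ nu f (@measurable_squaring R) inv_nu _ (@code R) (ln 2) (ln 3)).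
- exact: measurable_code.
- by rewrite ln_ge0// ler1n.
- exact: code_weights.
move=> k xi mxi e e0; apply: approximable_predict => //.
- exact: measurable_squaring.
- exact: measurable_code.
move=> i.
apply: (@approximable_sigma _ B R nu f _ (@code R) (@measurable_squaring R)
  (@measurable_code R) (@open S2)); last exact: mxi.
exact: open_approximable.
Qed.

End InvariantMeasure.
End SquaringEntropy.

(** * The circle measure has maximal entropy for the squaring map *)

Section CircleEntropy.
Variable R : realType.
Local Notation C := (Cplx R).
Local Notation B := (Borel R).
Local Notation f := (@squaring R : B -> B).
Local Notation m := (@circle_measure R).

Lemma invariant_squaring : invariant m f.
Proof.
move=> A mA; have := @circle_measure_monomial R 0 2 A (lexx 0) isT mA.
by rewrite cis0.
Qed.

Definition side (x : B) : 'I_2 := if `[< @upper R x >] then ord0 else ord_max.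

Lemma sideE : (side @^-1` [set ord0] = @upper R) /\
  (side @^-1` [set ord_max] = ~` @upper R).
Proof.
by split; apply/seteqP; split=> x /=; rewrite /side; case: asboolP.
Qed.

Lemma side_cases (i : 'I_2) : i = ord0 \/ i = ord_max.
Proof. by case: i => [[|[|//]] i2]; [left|right]; apply: val_inj. Qed.

Lemma measurable_side i : measurable (side @^-1` [set i]).
Proof.
have mu := @measurable_upper R; have [s0 s1] := sideE.
by have [->|->] := side_cases i; rewrite ?s0 ?s1//; exact: measurableC.
Qed.

Lemma circle_measure_side i (A : set B) : measurable A ->
  m (side @^-1` [set i] `&` f @^-1` A) = ((2^-1)%:E * m A)%E.
Proof.
move=> mA; have [s0 s1] := sideE; have mu := @measurable_upper R.
have H := circle_measure_upper mA.
have mfA : measurable (f @^-1` A).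
  by rewrite -[X in measurable X]setTI; exact: measurable_squaring.
have [->|->] := side_cases i; first by rewrite s0.
rewrite s1 setIC -setDE; rewrite measureD//; last first.
  by rewrite (le_lt_trans (probability_le1 _ _)) ?ltry.
rewrite [X in (_ - X)%E](_ : _ = ((2^-1)%:E * m A)%E); last by rewrite setIC.
rewrite [X in (X - _)%E](invariant_squaring mA).
have fin : m A \is a fin_num by exact: fin_num_measure.
have [a aE] : exists a, m A = a%:E by exists (fine (m A)); rewrite fineK.
suff half x y z : x = a%:E -> y = a%:E -> z = a%:E ->
  (x - (2^-1)%:E * y = (2^-1)%:E * z)%E by exact: half.
by move=> -> -> ->; rewrite -!EFinM -EFinB; congr EFin; lra.
Qed.

(** The first symbol is independent of the later ones and each symbol has probability 1/2. Indexing
    w by all naturals lets the induction shift it. *)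
Lemma circle_measure_word n (w : nat -> 'I_2) :
  m [set x | forall j, (j < n)%N -> side (iter j f x) = w j] = ((2^-1) ^+ n)%:E.
Proof.
elim: n w => [|n IH] w.
  rewrite expr0 (_ : [set x | _] = setT) ?probability_setT//.
  by apply/seteqP; split.
pose A : set B := [set x | forall j, (j < n)%N -> side (iter j f x) = w j.+1].
have mA : measurable A.
  have -> : A = \bigcap_(j in `I_n) (iter j f @^-1` (side @^-1` [set w j.+1])).
    by apply/seteqP; split=> x h j jn; exact: h.
  apply: bigcap_measurableType => j _.
  apply: measurable_iter_preimage; [exact: measurable_squaring|exact: measurable_side].
have -> : [set x | forall j, (j < n.+1)%N -> side (iter j f x) = w j] =
    side @^-1` [set w 0%N] `&` f @^-1` A.
  apply/seteqP; split=> [x h|x [h0 h] [_|j jn]] //.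
    split=> [|j jn]; first exact: (h 0%N).
    by rewrite -iterSr; exact: (h j.+1).
  by rewrite iterSr; exact: h.
by rewrite circle_measure_side// (IH (fun j => w j.+1)) -EFinM exprS.
Qed.

Lemma join_entropy_circle n : join_entropy m f side n = n%:R * ln 2.
Proof.
rewrite /join_entropy.
rewrite (eq_bigr (fun _ => (2^-1) ^+ n * (n%:R * ln 2))) => [|w _].
  rewrite sumr_const card_ffun !card_ord -mulrnAl.
  by rewrite -[X in X * _]mulr_natr natrX -exprMn mulVf ?expr1n ?mul1r// pnatr_eq0.
(* The values of w' from n on are arbitrary, since only the first n symbols are constrained. *)
pose w' j : 'I_2 := if insub j is Some i then w i else ord0.
have -> : [set x | forall j : 'I_n, side (iter j f x) = w j] =
    [set x | forall j, (j < n)%N -> side (iter j f x) = w' j].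
  apply/seteqP; split=> x h j.
    by move=> jn; rewrite /w' insubT; exact: (h (Ordinal jn)).
  by rewrite (h j (ltn_ord j)) /w' valK.
rewrite [X in fine X]circle_measure_word/= lnXn ?invr_gt0// lnV ?posrE//.
by rewrite -[_ *+ n]mulr_natl; ring.
Qed.

(** The bound ln 2, valid for every invariant measure, is attained here by the partition into two
    half planes. *)
Lemma circle_max_entropy : max_entropy_measure (@squaring R) m.
Proof.
split; first exact: invariant_squaring.
move=> nu inv_nu; apply: le_trans (squaring_entropy_le inv_nu) _.
apply: ereal_sup_ubound; exists 2%N, side; split; first exact: measurable_side.
(* At index 0 the division by 0 yields 0, so the sequence is constant only from 1 on. *)
apply/esym/cvg_lim => //; apply: cvg_near_cst; near=> n.
rewrite join_entropy_circle mulrAC divff ?mul1r// pnatr_eq0 -lt0n.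
by near: n; exists 1%N.
Unshelve. all: by end_near. Qed.

(** Being an N-th root of unity, c is a power of cis (1 / N), that is cis of a nonnegative angle, so
    z |-> c z ^ n fixes the circle measure. *)
Lemma E_squaring (c : C) N n : (0 < N)%N -> c ^+ N = 1 -> (0 < n)%N ->
  E (@squaring R) (monomial c n).
Proof.
move=> N0 cN n0; have [j cE] := @prim_rootP _ N _ (cis_prim R N0) c cN.
have c0 : c != 0.
  by apply/eqP => c0; move: cN => /eqP; rewrite c0 expr0n eqn0Ngt N0/= eq_sym oner_eq0.
split; first by apply: rational_poly; exact: monomial_size_gt1.
exists m; first exact: circle_max_entropy.
rewrite cE -cisMn; apply: lyubich_fixed_monomial => //.
Qed.

End CircleEntropy.

(** * The embedding of the quotient semigroup into the symmetries of z ^ 2 *)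

Theorem corollary34 (R : realType) (F : set (selfmap R))
    (polyF : forall f, F f -> polynomial_map f)
    (admF : admissable F)
    (amS : right_amenable R (Sgen F)) :
  exists (P : selfmap R) (phi : lcan_quot amS -> E P),
    [/\ polynomial_map P,
        (1 < deg P)%N,
        forall x y, val (phi (x * y)%g) = val (phi x) \o val (phi y)
      & injective phi].
Proof.
have [M M_mean M_inv] := amS.
have [g0 [Fg nex [y0 [B rootB]]]] := admissable_bounded polyF admF.
pose g : Sgen F := exist _ g0 (mem_set (gen_base Fg)).
have [inj [m m0 ratio]] := polyof_same_size polyF M_mean M_inv rootB (g := g) nex.
pose dg (s : Sgen F) := (size (polyof s)).-1.
pose lc (s : Sgen F) : R[i] := lead_coef (polyof s).
have size_dg s : size (polyof s) = (dg s).+1.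
  by rewrite /dg prednK// ltnW// size_polyof.
have dg0 s : (0 < dg s)%N by have := size_polyof polyF s; rewrite size_dg.
have lc0 s : lc s != 0.
  by rewrite lead_coef_eq0 -size_poly_gt0 size_dg.
have dgM s t : dg (s * t)%g = (dg s * dg t)%N.
  by rewrite /dg polyofM// size_comp_poly.
have lcM s t : lc (s * t)%g = lc s * lc t ^+ dg s.
  by rewrite /lc polyofM// lead_coef_comp// size_polyof.
have dg_lc_inj s t : dg s = dg t -> lc s = lc t -> s = t.
  by move=> dst; apply: inj; rewrite !size_dg dst.
have g1 : (1 < dg g)%N.
  rewrite ltn_neqAle dg0 andbT eq_sym; apply/eqP => d1; apply: nex; constructor 1.
  by rewrite -[g0]/(val g) (polyofE polyF g) deg_poly ?size_polyof.
have ratio' s t : dg s = dg t -> (lc s / lc t) ^+ m = 1.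
  by move=> dst; apply: ratio; rewrite !size_dg dst.
have [N [c [N0 cN cM cP]]] :=
  leading_coef_character dg0 dgM lc0 lcM dg_lc_inj g1 m0 ratio'.
have c0 s : (c s : Cplx R) != 0.
  apply/eqP => cs; have := cN s; rewrite cs expr0n eqn0Ngt N0/=.
  by move/eqP; rewrite eq_sym oner_eq0.
(* The class x goes to c z ^ n with c and n read off a representative; by [cP] the pair (n, c) is
   the same for all representatives and separates the classes. *)
have EP (x : lcan_quot amS) : monomial (c (repr x) : Cplx R) (dg (repr x)) \in E (@squaring R).
  by apply/mem_set; apply: E_squaring (cN _) _.
exists (@squaring R), (fun x => exist (fun q => q \in E (@squaring R)) _ (EP x)).
have s2 : (1 < size ((1 : Cplx R) *: 'X^2))%N by rewrite size_monomial ?oner_eq0.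
split.
- by exists (1 *: 'X^2).
- by rewrite /squaring /monomial deg_poly// size_monomial ?oner_eq0.
- move=> x y /=.
  (* The chosen representative of the product and the product of the representatives lie in the same
     class. *)
  have [dxy cxy] : dg (repr (x * y)%g) = dg (repr x * repr y)%g /\
      c (repr (x * y)%g) = c (repr x * repr y)%g.
    apply/cP; apply/asboolP; apply/(pi_lcanP amS); by rewrite reprK.
  rewrite dxy cxy dgM cM /monomial fracmap_poly_comp ?size_monomial ?ltnS//.
  congr (fracmap (_, _)).
  by rewrite comp_polyZ comp_Xn_poly exprZn scalerA -exprM mulnC.
move=> x y [] /fracmap_poly_inj xy.
have dxy : dg (repr x) = dg (repr y).
  have := congr1 (fun p : {poly Cplx R} => size p) xy.
  by rewrite !size_monomial// => -[].
have cxy : c (repr x) = c (repr y).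
  have := congr1 (fun p : {poly Cplx R} => p`_(dg (repr x))) xy.
  by rewrite !coefZ !coefXn dxy eqxx !mulr1.
have /cP/asboolP/(pi_lcanP amS) : dg (repr x) = dg (repr y) /\ c (repr x) = c (repr y) by [].
by rewrite !reprK.
Qed.
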